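(* Let $F$ be defined on $\mathbb{R}^+$ (with $F(0)=-\infty$ allowed). Assume that $F$ is continuous, increasing, concave, goes to $+\infty$ at $+\infty$ and satisfies $F(1)=0$; thus $F$ admits an inverse function $F^{-1}$ defined on $]F(0),+\infty[$. Assume in addition that $$F(xy) \leq F(x) + F(y)\qquad\text{for all positive } x,y .$$ Suppose that $\mu$ satisfies the $F$-Sobolev inequality $$\int f^2 \, F(f^2) \, d\mu \leq -\langle Lf,f\rangle_\mu \qquad\text{for all } f \in D(L) \text{ such that } \int f^2 d\mu =1 .$$ Let $V$ be $\mu$-integrable and let $\nu$ be a probability measure absolutely continuous with respect to $\mu$. (i) Let $\lambda_V$ be such that $\lambda V > F(0)$ for all $0 \leq \lambda < \lambda_V$, and set $$H^*(a) := \sup_{0\leq \lambda < \lambda_V} \left\{\lambda a - F\left(\int F^{-1}(\lambda V) \, d\mu \right)\right\}.$$ Then for all $R>0$ and $t>0$, $$\mathbb{P}_\nu\left(\frac 1t \int_0^t V(X_s) ds - \int V d\mu \geq R\right) \leq \left\| \frac{d\nu}{d\mu}\right\|_{\mathbb{L}^2(\mu)} \exp \left( - t \, H^*\Big(R+\int V d\mu\Big)\right).$$ (ii) Let $\lambda'_V$ be such that $\lambda (V - \int V d\mu) > F(0)$ for all $0 \leq \lambda < \lambda'_V$, and set $$H_c^*(a) := \sup_{0\leq \lambda < \lambda'_V} \left\{\lambda a - F\left(\int F^{-1}\Big(\lambda \big(V - \int V d\mu\big)\Big) \, d\mu \right)\right\}.$$ Then for all $R>0$ and $t>0$, $$\mathbb{P}_\nu\left(\frac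 1t \int_0^t V(X_s) ds - \int V d\mu \geq R\right) \leq \left\| \frac{d\nu}{d\mu}\right\|_{\mathbb{L}^2(\mu)} \exp \left( - t \, H_c^*(R)\right).$$ (iii) When $F(0)=-\infty$ (so that one may take $\lambda_V=\lambda'_V=+\infty$), the bound in (ii) is better than the bound in (i), i.e. $H_c^*(R)\ge H^*(R+\int V d\mu)$.
   Context: $E$ is a Polish space and $(X_t,(\mathbb{P}_x)_{x\in E})$ is a conservative continuous-time Markov process on $E$ with semigroup $(P_t)_{t\ge 0}$ and infinitesimal generator $L$ with domain $D(L)$ (in $\mathbb{L}^2(\mu)$). $\mu$ is a probability measure on $E$ that is invariant and ergodic for $(P_t)$. $\mathbb{P}_\nu$ denotes the law of the process with initial distribution $\nu$. $\langle\cdot,\cdot\rangle_\mu$ is the inner product of $\mathbb{L}^2(\mu)$. Conventions: $F(+\infty)=+\infty$; $F(0)$ is the (possibly infinite) limit of $F$ at $0$; the numbers $\lambda_V,\lambda_V'$ are in $(0,+\infty]$ (so if $F(0)>-\infty$ the statement applies only to $V$'s bounded from below). The right-hand sides are $+\infty$ if $d\nu/d\mu\notin\mathbb{L}^2(\mu)$. *)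

(* Defs.v *)
From HB Require Import structures.
From mathcomp Require Import all_boot all_order all_algebra.
From mathcomp Require Import all_classical all_reals all_analysis.

Set Implicit Arguments.
Unset Strict Implicit.
Unset Printing Implicit Defensive.

Import Order.TTheory GRing.Theory Num.Theory.
Import numFieldNormedType.Exports.

Local Open Scope classical_set_scope.
Local Open Scope ring_scope.

Definition polish (R : realType) (E : topologicalType) : Prop :=
  (exists2 D : set E, countable D & dense D) /\
  exists d : E -> E -> R,
    [/\ (forall x y, 0 <= d x y) /\ (forall x y, d x y = 0 <-> x = y),
        forall x y, d x y = d y x,
        forall x y z, d x z <= d x y + d y z,
        forall x (A : set E),
          nbhs x A <-> exists2 e, 0 < e & [set y | d x y < e] `<=` A &
        forall u : nat -> E,
          (forall e, 0 < e -> exists N : nat, forall m n : nat,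
            (N <= m)%N -> (N <= n)%N -> d (u m) (u n) < e) ->
          exists l : E, u @ \oo --> l].

Notation borel E := (g_sigma_algebraType (@open E)).

Section MarkovProcess.
Context (R : realType) (E : ptopologicalType).
Context (dO : measure_display) (Omega : measurableType dO).
Variables (X : R -> Omega -> borel E) (P : R.-pker (borel E) ~> Omega).

Definition history (t : R) : set (set Omega) :=
  <<s [set A | exists u (B : set (borel E)),
         [/\ 0 <= u <= t, measurable B & A = X u @^-1` B]] >>.

(* The time set is [0, +oo[: X t is only ever used for 0 <= t. Paths stay in E
   and every P x has mass 1, so the process is conservative. Joint measurability
   in (t, w) (implied by right-continuity of the paths) is what makes the time
   integral of V (X s) meaningful. *)
Record markov_process : Prop := MarkovProcess {
  markov_measurable :
    measurable_fun ((`[0, +oo[%classic : set (measurableTypeR R)) `*` [set: Omega])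
      (fun p : measurableTypeR R * Omega => X p.1 p.2) ;
  markov_start : forall x, P x [set w | X 0 w = x] = 1%E ;
  markov_property : forall (x : borel E) (s t : R) A (B : set (borel E)),
    0 <= s -> 0 <= t -> history s A -> measurable B ->
    P x (A `&` X (s + t) @^-1` B) =
    (\int[P x]_(w in A) P (X s w) (X t @^-1` B))%E
}.

Definition law_from (nu : probability (borel E) R) (A : set Omega) : \bar R :=
  (\int[nu]_x P x A)%E.

(* For f in L^2(mu), with mu invariant, the integral converges for mu-almost
   every x. *)
Definition semigroup (t : R) (f : borel E -> R) (x : borel E) : R :=
  \int[P x]_w f (X t w).

Variable mu : probability (borel E) R.

Definition invariant_measure : Prop :=
  forall (t : R) (B : set (borel E)), 0 <= t -> measurable B ->
    (\int[mu]_x P x (X t @^-1` B))%E = mu B.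

Definition ergodic_measure : Prop :=
  forall B : set (borel E), measurable B ->
    (forall t : R, 0 <= t ->
      {ae mu, forall x, P x (X t @^-1` B) = (\1_B x)%:E}) ->
    mu B = 0%E \/ mu B = 1%E.

(* [generator f g] says: f \in D(L) and L f = g in L^2(mu). Functions stand for
   their classes modulo mu-almost everywhere equality. *)
Definition generator (f g : borel E -> R) : Prop :=
  [/\ f \in Lfun mu 2%:E, g \in Lfun mu 2%:E &
      Lnorm mu 2%:E (fun x => (h^-1 * (semigroup h f x - f x) - g x)%:E)
        @[h --> 0^'+] --> 0%E].

(* The left-hand integral is extended-real valued: its not being +oo is part of
   the inequality. At points where f vanishes the integrand is 0, whatever the
   value of F at 0. *)
Definition F_sobolev (F : R -> R) : Prop :=
  forall f g, generator f g -> (\int[mu]_x (f x ^+ 2)%:E)%E = 1%E ->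
    (\int[mu]_x (f x ^+ 2 * F (f x ^+ 2))%:E <=
     (- \int[mu]_x (g x * f x))%:E)%E.

End MarkovProcess.

Section Gauge.
Context (R : realType).
Variable F : R -> R.

(* F is only used on ]0, +oo[; its value at 0 is the limit F_at0 below. *)
Record sobolev_gauge : Prop := SobolevGauge {
  gauge_continuous : {in `]0, +oo[, continuous F} ;
  gauge_increasing : {in `]0, +oo[ &, {homo F : x y / x < y}} ;
  gauge_concave :
    convex_function (`]0, +oo[%classic : set R) (fun x => - F x) ;
  gauge_pinfty : F x @[x --> +oo] --> +oo ;
  gauge1 : F 1 = 0
}.

Definition F_at0 : \bar R := lim ((F x)%:E @[x --> 0^'+]).

Definition F_ext (y : \bar R) : \bar R :=
  match y with
  | r%:E => if 0 < r then (F r)%:E else F_at0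
  | +oo%E => +oo%E
  | -oo%E => F_at0
  end.

(* The inverse of the restriction of F to ]0, +oo[, with value 0 outside
   ]F(0), +oo[. *)
Definition F_inv : R -> R := 'pinv_(fun=> 0) (`]0, +oo[%classic : set R) F.

Context (d : measure_display) (T : measurableType d) (mu : probability T R).

Definition admissible (V : T -> R) (lamV : \bar R) : Prop :=
  (0 < lamV)%E /\
  forall l : R, 0 <= l -> (l%:E < lamV)%E ->
    {ae mu, forall x, (F_at0 < (l * V x)%:E)%E}.

Definition H_star (V : T -> R) (lamV : \bar R) (a : R) : \bar R :=
  ereal_sup
    [set ((l * a)%:E - F_ext (\int[mu]_x (F_inv (l * V x))%:E))%E
      | l in [set l : R | 0 <= l /\ (l%:E < lamV)%E]].

(* The case distinction matters when the norm and h are both +oo, where the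
   library's convention for +oo * 0 would give 0 instead of +oo. *)
Definition deviation_bound (nu : probability T R) (t : R) (h : \bar R) :
    \bar R :=
  let N := Lnorm mu 2%:E (Radon_Nikodym (charge_of_finite_measure nu) mu) in
  (if N == +oo then +oo else N * expeR (- (t%:E * h)))%E.

End Gauge.

(* Main.v *)
Require Import Defs.
From HB Require Import structures.
From mathcomp Require Import all_boot all_order all_algebra.
From mathcomp Require Import all_classical all_reals all_analysis.
From mathcomp Require Import measurable_realfun.
From mathcomp Require Import ring lra.

(** The hypotheses on the gauge are rigid: a concave F on ]0, +oo[ with F 1 = 0
    and F (x y) <= F x + F y is k ln for some k > 0 [gauge_ln].  Hence F is
    minus infinity at 0, its inverse is y |-> exp (y / k), the F-Sobolev
    inequality is a logarithmic Sobolev inequality, and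
    F (int F^-1 (l V) dmu) = k ln int exp (l V / k) dmu.  Replacing V by V - m
    changes this number by l m, so the rate functions of V and of the centered
    V - m agree [H_star_shift]; their comparison is an equality.  There remains
    to bound, for a single l >= 0, the probability that
    int_0^t V (X_s) ds >= b.

    For a bounded W >= 0 let u_t(x) = E_x exp (int_0^t W (X_s) ds) be the
    Feynman-Kac function.  It solves d/dt u_t = L u_t + W u_t with u_0 = 1, so
    N(t) = int u_t^2 dmu satisfies N' = 2 (<L u_t, u_t> + <W u_t, u_t>).  The
    Sobolev inequality for u_t / |u_t| together with Gibbs' variational
    principle bounds the right-hand side by 2 c N, where
    c = k ln int exp (W / k) dmu [sobolev_energy]; thus |u_t| <= exp (c t)
    [feynman_kac_norm], and E_nu exp (int_0^t W (X_s) ds) = int u_t dnu is at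
    most |dnu/dmu| exp (c t) by Cauchy-Schwarz [exp_moment].  Chebyshev's
    inequality for truncations of l V, and Fatou's lemma to remove the
    truncation, finish the argument [deviation_exponential].

    The analytic point is that u_t belongs to the domain of L
    [generator_feynman_kac].  Continuity in time comes from the mean continuity of
    s |-> W (X_s) under the stationary law [increment_sqr_cvg]: averaging over
    the starting time, it reduces to the continuity of translations in L^1 along
    each path.  This continuity also makes Riemann sums converge to the time
    integral, so that the Markov property, which for finitely many times follows
    by induction [grid_expect], passes to the exponential of the time integral
    [feynman_kac_shift].  The difference quotient of h |-> P_h u_t is then an
    explicit expectation, controlled by the time integrals over [0, h] and
    [t, t + h]. *)

Set Implicit Arguments.
Unset Strict Implicit.
Unset Printing Implicit Defensive.

Import Order.TTheory GRing.Theory Num.Theory.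
Import numFieldNormedType.Exports.

Local Open Scope classical_set_scope.
Local Open Scope ring_scope.

(** * Submultiplicative gauges are logarithms *)

Section gauge.
Context (R : realType).
Implicit Types (x y : R).

Lemma expR_quad x : x <= 2^-1 -> `|expR x - 1 - x| <= 2 * x ^+ 2.
Proof.
move=> x2; have e1 := expR_ge1Dx x.
rewrite ger0_norm; last by lra.
have e2 := expR_ge1Dx (- x); rewrite expRN in e2.
have e0 := expR_gt0 x.
have : (1 - x) * expR x <= 1 by rewrite -ler_pdivlMr// div1r.
have x20 : 0 <= x ^+ 2 by exact: sqr_ge0.
move: (expR x) e1 e2 e0 => e e1 e2 e0 H.
have h : (1 - x) * (1 + x + 2 * x ^+ 2) = 1 + x ^+ 2 * (1 - 2 * x) by ring.
have h2 : 0 <= x ^+ 2 * (1 - 2 * x) by apply: mulr_ge0 => //; lra.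
suff : e <= 1 + x + 2 * x ^+ 2 by lra.
by rewrite -(ler_pM2l (_ : 0 < 1 - x)) ?h; lra.
Qed.

Lemma ler_add_invn x y c : (forall n : nat, (0 < n)%N -> x <= y + c / n%:R) ->
  x <= y.
Proof.
move=> H; rewrite leNgt; apply/negP => yx.
have d0 : 0 < x - y by rewrite subr_gt0.
have c0 : 0 < c by have := H 1 isT; rewrite divr1; lra.
set n := Num.bound (c / (x - y)).
have := @archi_boundP _ (c / (x - y)) (ltW (divr_gt0 c0 d0)).
rewrite -/n => cn.
have n0 : (0 < n%:R :> R) by apply: le_lt_trans cn; apply/ltW/divr_gt0.
have := H n; rewrite -(ltr_nat R) => /(_ n0).
apply/negP; rewrite -ltNge -ltrBrDl ltr_pdivrMr// mulrC -ltr_pdivrMr//.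
Qed.

Variable F : R -> R.
Hypothesis gaugeF : sobolev_gauge F.

(** The slopes of the chords over [1, b] are below those of the chords over
    [a, 1]; the supremum of the former is the slope of a line through (1, 0)
    above the graph of F. *)
Lemma gauge_tangent1 : exists p, forall x, 0 < x -> F x <= p * (x - 1).
Proof.
have F1 := gauge1 gaugeF.
have H a b : 0 < a -> a < 1 -> 1 < b -> F b / (b - 1) <= F a / (a - 1).
  move=> a0 a1 b1; have [ba1 ba2 ba3] : [/\ b - 1 != 0, a - 1 != 0 & b - a != 0].
    by split; rewrite subr_eq0; [rewrite gt_eqF|rewrite lt_eqF|rewrite gt_eqF//; lra].
  have t01 : 0 <= (b - 1) / (b - a) <= 1.
    apply/andP; split; first by apply: divr_ge0; lra.
    by rewrite ler_pdivrMr; lra.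
  have := gauge_concave gaugeF (@Itv01 R _ (andP t01).1 (andP t01).2) (x := a)
   (y := b).
  rewrite !inE/= !in_itv/= !andbT => /(_ a0 (lt_trans ltr01 b1)).
  rewrite !convRE /=.
  rewrite [X in - F X <= _](_ : _ = 1); last first.
    change ((b - 1) / (b - a) * a + (1 - (b - 1) / (b - a)) * b = 1).
    by field.
  rewrite /unstable.onem.
  rewrite F1 oppr0.
  have -> : (b - 1) / (b - a) * - F a + (1 - (b - 1) / (b - a)) * - F b =
     (F b / (b - 1) - F a / (a - 1)) * ((b - 1) * (a - 1) / (b - a)).
    by field; rewrite ba1 ba2 ba3.
  rewrite nmulr_lge0; first by rewrite subr_le0.
  by rewrite pmulr_llt0 ?invr_gt0; [rewrite pmulr_rlt0; lra|lra].
pose S := [set F b / (b - 1) | b in [set b | 1 < b]].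
have S0 : S !=set0 by exists (F 2 / (2 - 1)); exists 2 => //=; lra.
have ubS a : 0 < a -> a < 1 -> ubound S (F a / (a - 1)).
  by move=> a0 a1 _ [b /= b1 <-]; exact: H.
exists (sup S) => x x0; have [x1|x1|->] := ltgtP x 1; last first.
- by rewrite F1 subrr mulr0.
- rewrite -ler_pdivrMr ?subr_gt0//; apply: ub_le_sup; last by exists x.
  by exists (F (2^-1) / (2^-1 - 1)); apply: ubS; lra.
- rewrite -ler_ndivlMr ?subr_lt0//; apply: ge_sup => //; exact: ubS.
Qed.

Hypothesis F_submul : forall x y : R, 0 < x -> 0 < y -> F (x * y) <= F x + F y.

(** The function psi s = F (exp s) is subadditive, so psi s <= n psi (s / n),
    and the tangent at 1 bounds this by n p (exp (s / n) - 1), which tends to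
    p s.  Since 0 = psi 0 <= psi s + psi (- s), also psi s >= p s. *)
Lemma gauge_ln : exists2 k, 0 < k & forall x, 0 < x -> F x = k * ln x.
Proof.
have [p Fp] := gauge_tangent1; have F1 := gauge1 gaugeF.
have FX x n : 0 < x -> F (x ^+ n) <= n%:R * F x.
  move=> x0; elim: n => [|n IH]; first by rewrite expr0 F1 mul0r.
  rewrite exprS -natr1 mulrDl mul1r addrC (le_trans (F_submul _ _))//.
    by rewrite exprn_gt0.
  by rewrite lerD2l.
have Fle x : 0 < x -> F x <= p * ln x.
  (* The first summand is the second order error of the exponential, valid when
     s <= 1/2; the second one makes the estimate trivial for the other n. *)
  move=> x0; apply: (@ler_add_invn _ _ (`|p| * 2 * (ln x) ^+ 2 +
     (`|F x| + `|p * ln x|) * (2 * `|ln x|))) => n n0.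
  have n0R : 0 < n%:R :> R by rewrite ltr0n.
  pose s := ln x / n%:R.
  have Hs : 0 <= `|p| * 2 * (ln x) ^+ 2.
    by apply: mulr_ge0; [exact: mulr_ge0|exact: sqr_ge0].
  have [s2|s2] := leP s 2^-1.
    have : F x <= n%:R * (p * (expR s - 1)).
      apply: (@le_trans _ _ (n%:R * F (expR s))); last first.
        by rewrite ler_pM2l// Fp// expR_gt0.
      apply: le_trans (FX _ _ (expR_gt0 _)).
      by rewrite -expRM_natl mulrC /s divfK ?lt0r_neq0// lnK.
    move=> h; apply: (le_trans h).
    have -> : n%:R * (p * (expR s - 1)) = n%:R * (p * s) + n%:R * (p * (expR s - 1 - s)).
      by ring.
    have -> : n%:R * (p * s) = p * ln x by rewrite /s; field; rewrite lt0r_neq0.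
    rewrite lerD2l.
    apply: (@le_trans _ _ (`|p| * 2 * ln x ^+ 2 / n%:R)); last first.
      rewrite ler_pM2r ?invr_gt0// lerDl mulr_ge0// ?addr_ge0// mulr_ge0//.
    rewrite ler_pdivlMr//.
    apply: (@le_trans _ _ (n%:R ^+ 2 * (`|p| * `|expR s - 1 - s|))).
      have -> : n%:R * (p * (expR s - 1 - s)) * n%:R = n%:R ^+ 2 * (p * (expR s - 1 - s)) by ring.
      by rewrite ler_pM2l ?exprn_gt0// -normrM ler_norm.
    have -> : `|p| * 2 * ln x ^+ 2 = n%:R ^+ 2 * (`|p| * (2 * s ^+ 2)).
      by rewrite /s; field; rewrite lt0r_neq0.
    rewrite ler_pM2l ?exprn_gt0// ler_wpM2l//; exact: expR_quad.
  have n2 : n%:R <= 2 * `|ln x|.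
    rewrite /s ltr_pdivlMr// in s2; have := ler_norm (ln x); lra.
  have hp := ler_norm (- (p * ln x)); rewrite normrN in hp.
  have hF := ler_norm (F x).
  suff : `|F x| + `|p * ln x| <= (`|p| * 2 * ln x ^+ 2 + (`|F x| + `|p * ln x|) * (2
    * `|ln x|)) / n%:R.
    lra.
  rewrite ler_pdivlMr//.
  apply: (@le_trans _ _ ((`|F x| + `|p * ln x|) * (2 * `|ln x|))).
    by rewrite ler_wpM2l// addr_ge0.
  by rewrite lerDr.
have Feq x : 0 < x -> F x = p * ln x.
  move=> x0; apply/eqP; rewrite eq_le Fle//=.
  have := F_submul x0 (_ : 0 < x^-1); rewrite invr_gt0 => /(_ x0).
  rewrite divff ?lt0r_neq0// F1.
  have := Fle x^-1; rewrite invr_gt0 lnV ?posrE// => /(_ x0).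
  lra.
exists p => //.
have := gauge_increasing gaugeF (x := 1) (y := expR 1).
rewrite !in_itv/= !andbT ltr01 expR_gt0 F1 Feq ?expR_gt0// expRK mulr1.
by apply => //; rewrite expR_gt1.
Qed.

End gauge.

Section log_gauge.
Context (R : realType) (F : R -> R) (k : R) (k0 : 0 < k).
Hypothesis F_ln : forall x, 0 < x -> F x = k * ln x.

Lemma F_inv_ln y : F_inv F y = expR (y / k).
Proof.
have {1}-> : y = F (expR (y / k)).
  by rewrite F_ln ?expR_gt0// expRK mulrC divfK ?gt_eqF.
rewrite /F_inv pinvKV//; last by rewrite inE/= in_itv/= expR_gt0.
move=> u v; rewrite !inE/= !in_itv/= !andbT => u0 v0.
rewrite !F_ln// => /mulfI => /(_ (lt0r_neq0 k0)) h.
by apply: ln_inj; rewrite ?posrE.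
Qed.

End log_gauge.

(** * Extending identities from events to functions *)

Section daniell.
Local Open Scope ereal_scope.
Context (R : realType).

Definition nnmeas d (T : measurableType d) (f : T -> \bar R) :=
  measurable_fun [set: T] f /\ forall x, 0 <= f x.

(** The functionals on nonnegative functions that are integrals for some
    measure, described without the measure: the closure lemmas below recognize
    expressions built from integrals, weights, substitutions and kernels, and
    [daniell_ext] compares two of them on events. *)
Record daniell d (T : measurableType d) (I : (T -> \bar R) -> \bar R) : Prop :=
  Daniell {
  daniellD : forall f g, nnmeas f -> nnmeas g -> I (f \+ g) = I f + I g;
  daniellZ : forall (c : R) f, (0 <= c)%R -> nnmeas f ->
    I (fun x => c%:E * f x) = c%:E * I f;
  daniell_lim : forall (f_ : nat -> T -> \bar R) f,
    (forall n, nnmeas (f_ n)) -> (forall x, nondecreasing_seq (f_ ^~ x)) ->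
    (forall x, f_ ^~ x @ \oo --> f x) -> I f = limn (I \o f_) }.

Lemma nnmeasD d (T : measurableType d) (f g : T -> \bar R) :
  nnmeas f -> nnmeas g -> nnmeas (f \+ g).
Proof.
move=> [mf f0] [mg g0]; split; first exact: emeasurable_funD.
by move=> x; rewrite adde_ge0.
Qed.

Lemma nnmeasM d (T : measurableType d) (f g : T -> \bar R) :
  nnmeas f -> nnmeas g -> nnmeas (f \* g).
Proof.
move=> [mf f0] [mg g0]; split; first exact: emeasurable_funM.
by move=> x; rewrite mule_ge0.
Qed.

Lemma nnmeasZ d (T : measurableType d) (f : T -> \bar R) (c : R) :
  (0 <= c)%R -> nnmeas f -> nnmeas (fun x => c%:E * f x).
Proof.
move=> c0 [mf f0]; split; first exact: measurable_funeM.
by move=> x; rewrite mule_ge0// lee_fin.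
Qed.

Lemma nnmeas_indic d (T : measurableType d) (A : set T) :
  measurable A -> nnmeas (fun x => (\1_A x)%:E : \bar R).
Proof.
move=> mA; split; first exact/measurable_EFinP/measurable_indic.
by move=> x; rewrite lee_fin.
Qed.

Lemma nnmeas_comp d d' (T : measurableType d) (T' : measurableType d')
  (h : T -> T') (f : T' -> \bar R) : measurable_fun setT h -> nnmeas f ->
  nnmeas (f \o h).
Proof. by move=> mh [mf f0]; split => [|x]; [exact: measurableT_comp|exact: f0]. Qed.

Lemma nnmeas_kernel d d' (T : measurableType d) (T' : measurableType d')
  (k : R.-ker T ~> T') (f : T' -> \bar R) : nnmeas f ->
  nnmeas (fun y => \int[k y]_z f z).
Proof.
move=> [mf f0]; split; last by move=> x; exact: integral_ge0.
by apply: measurable_fun_integral_kernel => // U mU; exact: measurable_kernel.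
Qed.

Lemma daniell_integral d (T : measurableType d) (mu : {measure set T -> \bar R}) :
  daniell (fun f => \int[mu]_x f x).
Proof.
split.
- by move=> f g [mf f0] [mg g0]; rewrite ge0_integralD.
- by move=> c f c0 [mf f0]; rewrite ge0_integralZl_EFin.
- move=> f_ f mf ndf cvf; rewrite -(@monotone_convergence _ _ _ mu)//.
  + by apply: eq_integral => x _; exact/esym/cvg_lim.
  + by move=> n; exact: (mf n).1.
  + by move=> n x _; exact: (mf n).2.
Qed.

Lemma daniell_weight d (T : measurableType d) I (z : T -> R) :
  measurable_fun setT z -> (forall x, (0 <= z x)%R) -> @daniell d T I ->
  daniell (fun f => I (fun x => (z x)%:E * f x)).
Proof.
move=> mz z0 dI; have zz : nnmeas (EFin \o z).
  by split; [exact/measurable_EFinP|move=> x /=; rewrite lee_fin].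
split.
- move=> f g mf mg; rewrite -(daniellD dI (nnmeasM zz mf) (nnmeasM zz mg)).
  congr I; apply/funext => x /=; rewrite ge0_muleDr//; [exact: mf.2|exact: mg.2].
- move=> c f c0 mf; rewrite -(daniellZ dI c0 (nnmeasM zz mf)).
  by congr I; apply/funext => x /=; rewrite muleCA.
- move=> f_ f mf ndf cvf.
  apply: (daniell_lim dI (f_ := fun n x => (z x)%:E * f_ n x)).
  + by move=> n; exact: (nnmeasM zz (mf n)).
  + by move=> x m n mn; rewrite lee_wpmul2l ?lee_fin//; exact: ndf.
  + by move=> x; apply: cvgeZl => //; exact: cvf.
Qed.

Lemma daniell_comp d d' (T : measurableType d) (T' : measurableType d') I
    (h : T -> T') : measurable_fun setT h -> @daniell d T I ->
  daniell (fun f : T' -> \bar R => I (fun x => f (h x))).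
Proof.
move=> mh dI; split.
- by move=> f g mf mg; rewrite -(daniellD dI (nnmeas_comp mh mf) (nnmeas_comp mh mg)).
- by move=> c f c0 mf; rewrite -(daniellZ dI c0 (nnmeas_comp mh mf)).
- move=> f_ f mf ndf cvf.
  apply: (daniell_lim dI (f_ := fun n x => f_ n (h x))).
  + by move=> n; exact: (nnmeas_comp mh (mf n)).
  + by move=> x; exact: ndf.
  + by move=> x; exact: cvf.
Qed.

Lemma daniell_kernel d d' (T : measurableType d) (T' : measurableType d') I
    (k : R.-ker T ~> T') : @daniell d T I ->
  daniell (fun f : T' -> \bar R => I (fun y => \int[k y]_z f z)).
Proof.
move=> dI; split.
- move=> f g mf mg; rewrite -(daniellD dI (nnmeas_kernel k mf) (nnmeas_kernel k mg)).
  by congr I; apply/funext => y; rewrite (daniellD (daniell_integral (k y))).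
- move=> c f c0 mf; rewrite -(daniellZ dI c0 (nnmeas_kernel k mf)).
  by congr I; apply/funext => y; rewrite (daniellZ (daniell_integral (k y))).
- move=> f_ f mf ndf cvf.
  have ndk y : nondecreasing_seq (fun n => \int[k y]_z f_ n z).
    move=> m n mn; apply: ge0_le_integral => //.
    + by move=> z _; exact: (mf m).2.
    + exact: (mf m).1.
    + exact: (mf n).1.
    + by move=> z _; exact: ndf.
  apply: (daniell_lim dI (f_ := fun n y => \int[k y]_z f_ n z)) => //.
  + by move=> n; exact: nnmeas_kernel.
  + move=> y; rewrite (daniell_lim (daniell_integral (k y)) mf ndf cvf).
    exact: ereal_nondecreasing_is_cvgn.
Qed.

Import HBNNSimple.

Lemma daniell_ext d (T : measurableType d) I J : @daniell d T I -> daniell J ->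
  (forall A, measurable A ->
    I (fun x => (\1_A x)%:E) = J (fun x => (\1_A x)%:E)) ->
  forall f, nnmeas f -> I f = J f.
Proof.
move=> dI dJ IJ f [mf f0].
pose f_ := nnsfun_approx measurableT mf.
have nnf (g : {nnsfun T >-> R}) : nnmeas (EFin \o g).
  by split; [exact/measurable_EFinP|move=> x /=; rewrite lee_fin].
have sumIJ (s : seq R) (g : {nnsfun T >-> R}) :
    let h x := \sum_(r <- s | (0 <= r)%R) r%:E * (\1_(g @^-1` [set r]) x)%:E in
    nnmeas h /\ I h = J h.
  elim: s => [|r s [IH1 IH2]] /=.
    under eq_fun do rewrite big_nil.
    have n0 : nnmeas (fun x : T => 0 : \bar R) by split.
    split => //; have := daniellZ dI (lexx 0%R) n0; have := daniellZ dJ (lexx 0%R) n0.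
    have -> : (fun x : T => 0%:E * 0) = (fun=> 0) :> (T -> \bar R).
      by apply/funext => x; rewrite mul0e.
    by rewrite !mul0e => -> ->.
  have m1 : nnmeas (fun x => (\1_(g @^-1` [set r]) x)%:E : \bar R).
    exact: nnmeas_indic.
  have [r0|r0] := leP 0%R r; last first.
    by under eq_fun do rewrite big_cons leNgt r0 /=.
  under eq_fun do rewrite big_cons r0.
  have m2 := nnmeasZ r0 m1.
  split; first exact: nnmeasD m2 IH1.
  by rewrite (daniellD dI m2 IH1) (daniellD dJ m2 IH1) IH2
    (daniellZ dI r0 m1) (daniellZ dJ r0 m1) IJ.
have IJ_ n : I (EFin \o f_ n) = J (EFin \o f_ n).
  have -> : EFin \o f_ n = fun x => \sum_(r <- finmap.enum_fset (fset_set (range (f_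
    n))) | (0 <= r)%R) r%:E * (\1_(f_ n @^-1` [set r]) x)%:E.
    apply/funext => x /=; rewrite fimfunE -fsumEFin// fsbig_finite//=.
    rewrite [LHS]big_seq [RHS]big_seq_cond; apply: congr_big => // r.
    case: (boolP (r \in _)) => //=; rewrite in_fset_set// inE/= => -[y _ <-].
    by apply/esym/fun_ge0.
  exact: (sumIJ _ (f_ n)).2.
have ndf x : nondecreasing_seq (fun n => (f_ n x)%:E).
  by move=> m n mn; rewrite lee_fin; exact/lefP/nd_nnsfun_approx.
have cvf x : (f_ n x)%:E @[n --> \oo] --> f x by exact: cvg_nnsfun_approx.
have lim_f K : daniell K -> K f = limn (fun n => K (EFin \o f_ n)).
  by move=> dK; apply: (daniell_lim dK (f_ := fun n => EFin \o f_ n)).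
rewrite !lim_f//; have -> // : (fun n => I (EFin \o f_ n)) = (fun n => J (EFin \o f_ n)).
by apply/funext => n; exact: IJ_.
Qed.

End daniell.

(** * Bounded measurable functions *)

Section bmeas.
Context (R : realType).

(** Every probability measure integrates these functions, so that identities
    between their expectations carry no integrability conditions. *)
Definition bmeas d (T : measurableType d) (f : T -> R) :=
  measurable_fun [set: T] f /\ exists M : R, forall x, `|f x| <= M.

Section stability.
Context d (T : measurableType d).
Implicit Types (f g : T -> R).

Lemma bmeas_cst c : bmeas (fun _ : T => c).
Proof. by split; [exact: measurable_cst|exists `|c|]. Qed.

Lemma bmeasD f g : bmeas f -> bmeas g -> bmeas (fun x => f x + g x).
Proof.
move=> [mf [M fM]] [mg [N gN]]; split; first exact: measurable_funD.
by exists (M + N) => x; rewrite (le_trans (ler_normD _ _))// lerD.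
Qed.

Lemma bmeasM f g : bmeas f -> bmeas g -> bmeas (fun x => f x * g x).
Proof.
move=> [mf [M fM]] [mg [N gN]]; split; first exact: measurable_funM.
by exists (M * N) => x; rewrite normrM ler_pM.
Qed.

Lemma bmeasZ c f : bmeas f -> bmeas (fun x => c * f x).
Proof. by move=> bf; exact: bmeasM (bmeas_cst c) bf. Qed.

Lemma bmeasN f : bmeas f -> bmeas (fun x => - f x).
Proof.
move=> [mf [M fM]]; split; first exact: measurableT_comp.
by exists M => x; rewrite normrN.
Qed.

Lemma bmeasB f g : bmeas f -> bmeas g -> bmeas (fun x => f x - g x).
Proof. by move=> bf bg; exact: bmeasD bf (bmeasN bg). Qed.

Lemma bmeasX f n : bmeas f -> bmeas (fun x => f x ^+ n).
Proof.
move=> [mf [M fM]]; split; first exact: measurable_funX.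
by exists (M ^+ n) => x; rewrite normrX lerXn2r// nnegrE (le_trans _ (fM x)).
Qed.

Lemma bmeas_norm f : bmeas f -> bmeas (fun x => `|f x|).
Proof.
move=> [mf [M fM]]; split; first exact: measurableT_comp.
by exists M => x; rewrite normr_id.
Qed.

Lemma bmeas_expR f : bmeas f -> bmeas (fun x => expR (f x)).
Proof.
move=> [mf [M fM]]; split; first exact: measurableT_comp.
exists (expR M) => x; rewrite ger0_norm ?expR_ge0// ler_expR.
by rewrite (le_trans _ (fM x))// ler_norm.
Qed.

Lemma bmeas_sum (I : Type) (s : seq I) (f : I -> T -> R) :
  (forall i, bmeas (f i)) -> bmeas (fun x => \sum_(i <- s) f i x).
Proof.
move=> bf; elim: s => [|i s IH].
  by under eq_fun do rewrite big_nil; exact: bmeas_cst.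
by under eq_fun do rewrite big_cons; exact: bmeasD.
Qed.

Lemma bmeas_bounded f M : measurable_fun setT f -> (forall x, `|f x| <= M) ->
  bmeas f.
Proof. by move=> mf fM; split => //; exists M. Qed.

Lemma bmeas_ge0_le f M : measurable_fun setT f -> (forall x, 0 <= f x) ->
  (forall x, f x <= M) -> bmeas f.
Proof. by move=> mf f0 fM; apply: (bmeas_bounded mf) => x; rewrite ger0_norm. Qed.

Lemma bmeas_comp d' (T' : measurableType d') (h : T' -> T) f :
  measurable_fun setT h -> bmeas f -> bmeas (fun x => f (h x)).
Proof.
move=> mh [mf [M fM]]; split; first exact: (measurableT_comp mf mh).
by exists M => x; exact: fM.
Qed.

End stability.

Section expectation.
Context d (T : measurableType d) (m : {measure set T -> \bar R}).
Hypothesis m1 : m setT = 1%E.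
Implicit Types (f g : T -> R).

Lemma bmeas_integrable f : bmeas f -> m.-integrable setT (EFin \o f).
Proof.
move=> [mf [M fM]]; apply: measurable_bounded_integrable => //.
  by rewrite m1 ltry.
exists M; split; first exact: num_real.
by move=> N MN x _ /=; rewrite (le_trans (fM x))// ltW.
Qed.

Lemma expectD f g : bmeas f -> bmeas g ->
  \int[m]_x (f x + g x) = \int[m]_x f x + \int[m]_x g x.
Proof. by move=> bf bg; rewrite RintegralD//; exact: bmeas_integrable. Qed.

Lemma expectB f g : bmeas f -> bmeas g ->
  \int[m]_x (f x - g x) = \int[m]_x f x - \int[m]_x g x.
Proof. by move=> bf bg; rewrite RintegralB//; exact: bmeas_integrable. Qed.

Lemma expectZ c f : bmeas f -> \int[m]_x (c * f x) = c * \int[m]_x f x.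
Proof. by move=> bf; rewrite RintegralZl//; exact: bmeas_integrable. Qed.

Lemma expect_cst c : \int[m]_x c = c.
Proof. by rewrite Rintegral_cst// m1 mulr1. Qed.

Lemma expect_le f g : bmeas f -> bmeas g -> (forall x, f x <= g x) ->
  \int[m]_x f x <= \int[m]_x g x.
Proof.
by move=> bf bg fg; apply: le_Rintegral => //; exact: bmeas_integrable.
Qed.

Lemma expect_ge0 f : (forall x, 0 <= f x) -> 0 <= \int[m]_x f x.
Proof. by move=> f0; apply: Rintegral_ge0. Qed.

Lemma expect_norm f : bmeas f -> `|\int[m]_x f x| <= \int[m]_x `|f x|.
Proof.
by move=> bf; apply: le_normr_Rintegral => //; exact: bmeas_integrable.
Qed.

Lemma expect_norm_le f M : bmeas f -> (forall x, `|f x| <= M) ->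
  `|\int[m]_x f x| <= M.
Proof.
move=> bf fM; rewrite (le_trans (expect_norm bf))// -[leRHS]expect_cst.
by apply: expect_le => //; [exact: bmeas_norm|exact: bmeas_cst].
Qed.

Lemma expect_EFin f : bmeas f -> (\int[m]_x f x)%:E = (\int[m]_x (f x)%:E)%E.
Proof.
move=> bf; rewrite /Rintegral fineK//.
exact: integrable_fin_num (bmeas_integrable bf).
Qed.

Lemma expect_eq f g : (forall x, f x = g x) -> \int[m]_x f x = \int[m]_x g x.
Proof. by move=> fg; apply: eq_Rintegral => x _. Qed.

End expectation.

(** Measurability is reduced to nonnegative integrands by adding a bound. *)
Lemma bmeas_kernel d d' (T : measurableType d) (T' : measurableType d')
    (k : R.-pker T ~> T') (f : T' -> R) : bmeas f ->
  bmeas (fun x => \int[k x]_y f y).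
Proof.
move=> bf; have [mf [M fM]] := bf.
apply: (@bmeas_bounded _ _ _ M); last first.
  by move=> x; apply: (expect_norm_le (prob_kernel x) bf).
have M0 y : 0 <= f y + M.
  by rewrite -lerBlDr sub0r; have := fM y; rewrite ler_norml => /andP[].
have -> : (fun x => \int[k x]_y f y) =
    (fun x => fine (\int[k x]_y (f y + M)%:E)%E - M).
  apply/funext => x; have k1 := @prob_kernel _ _ _ _ _ k x.
  have bM := bmeas_cst T' M.
  by rewrite -(expect_EFin k1 (bmeasD bf bM)) /= (expectD k1 bf bM) (expect_cst k1) addrK.
apply: measurable_funB => //; apply: measurableT_comp => //.
have [] := @nnmeas_kernel R _ _ _ _ k (fun y => (f y + M)%:E) => //; split.
  by apply/measurable_EFinP; exact: measurable_funD.
by move=> y; rewrite lee_fin.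
Qed.

End bmeas.

(** * The law of the process with a random starting point *)

Section law.
Context (R : realType) (E : ptopologicalType) (dO : measure_display)
  (Omega : measurableType dO) (P : R.-pker (borel E) ~> Omega)
  (mu : probability (borel E) R).

Let law0 : law_from P mu set0 = 0%E.
Proof. by apply: integral0_eq => x _; rewrite measure0. Qed.

Let law_ge0 A : (0 <= law_from P mu A)%E.
Proof. exact: integral_ge0. Qed.

Let law_additive : semi_sigma_additive (law_from P mu).
Proof.
move=> F mF tF mUF.
have -> : law_from P mu (\bigcup_n F n) =
    (\int[mu]_x \big[+%E/0%E]_(0 <= n <oo) P x (F n))%E.
  by apply: eq_integral => x _; rewrite measure_semi_bigcup.
rewrite integral_nneseries//; last by move=> n; exact: measurable_kernel.
exact: is_cvg_ereal_nneg_natsum.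
Qed.

HB.instance Definition _ := isMeasure.Build _ _ _ (law_from P mu)
  law0 law_ge0 law_additive.

Lemma law_setT : law_from P mu setT = 1%E.
Proof.
rewrite -(@probability_setT _ _ _ mu) -[in RHS](mul1e (mu setT)).
rewrite -integral_cst//; apply: eq_integral => x _; exact: prob_kernel.
Qed.

HB.instance Definition _ :=
  Measure_isProbability.Build _ _ _ (law_from P mu) law_setT.

Lemma ge0_integral_law (f : Omega -> \bar R) : nnmeas f ->
  (\int[law_from P mu]_w f w = \int[mu]_x \int[P x]_w f w)%E.
Proof.
move=> nf.
have H : forall A, measurable A -> (\int[law_from P mu]_x (\1_A x)%:E)%E =
   (\int[mu]_x \int[P x]_w (\1_A w)%:E)%E.
  move=> A mA; rewrite integral_indic// setIT; apply: eq_integral => x _.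
  by rewrite integral_indic// setIT.
exact: (daniell_ext (daniell_integral _)
  (daniell_kernel P (daniell_integral mu)) H nf).
Qed.

Lemma expect_law (f : Omega -> R) : bmeas f ->
  \int[law_from P mu]_w f w = \int[mu]_x \int[P x]_w f w.
Proof.
have law1 := law_setT; have mu1 := @probability_setT _ _ _ mu.
have pos g : bmeas g -> (forall w, 0 <= g w) ->
    \int[law_from P mu]_w g w = \int[mu]_x \int[P x]_w g w.
  move=> bg g0; apply: EFin_inj.
  rewrite (expect_EFin law1 bg) (expect_EFin mu1 (bmeas_kernel P bg)).
  rewrite ge0_integral_law; last first.
    split; last by move=> w; rewrite lee_fin.
    by apply/measurable_EFinP; case: bg.
  apply: eq_integral => x _.
  by rewrite -(expect_EFin (prob_kernel x) bg).
move=> bf; have [mf [M fM]] := bf.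
have bM := bmeas_cst Omega M.
have := pos _ (bmeasD bf bM); rewrite (expectD law1 bf bM) (expect_cst law1).
have -> : (fun x => \int[P x]_w (f w + M)) = (fun x => \int[P x]_w f w + M).
  apply/funext => x.
  by rewrite (expectD (prob_kernel x) bf bM) (expect_cst (prob_kernel x)).
rewrite (expectD mu1 (bmeas_kernel P bf) (bmeas_cst _ M)) (expect_cst mu1).
move=> h; apply: (addIr M); apply: h => w.
by rewrite -lerBlDr sub0r; have := fM w; rewrite ler_norml => /andP[].
Qed.

End law.

(** * The Markov property with functionals of the past *)

Section markov.
Context (R : realType) (E : ptopologicalType) (dO : measure_display)
  (Omega : measurableType dO) (X : R -> Omega -> borel E)
  (P : R.-pker (borel E) ~> Omega).
Hypothesis markovX : markov_process X P.

(** The absolute value extends the paths to negative times, which makes them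
    jointly measurable on a full product space. *)
Lemma measurable_path :
  measurable_fun setT (fun p : measurableTypeR R * Omega => X `|p.1| p.2).
Proof.
have mX := markov_measurable markovX.
apply: (measurable_comp (g := fun p : measurableTypeR R * Omega =>
  (`|p.1| : measurableTypeR R, p.2)) _ _ mX).
- by apply: measurableX => //; exact: measurable_itv.
- by move=> _ [[u w] _ <-]; split => //=; rewrite in_itv/= normr_ge0.
- apply/measurable_fun_pairP; split.
    by apply: (measurableT_comp (@normr_measurable R setT)); exact: measurable_fst.
  exact: measurable_snd.
Qed.

Lemma measurable_X u : 0 <= u -> measurable_fun setT (X u).
Proof.
move=> u0; have -> : X u = (fun p : measurableTypeR R * Omega => X `|p.1| p.2)
    \o (fun w => (u, w)).
  by apply/funext => w /=; rewrite ger0_norm.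
by apply: measurableT_comp measurable_path _; exact: measurable_pair1.
Qed.

(** The generating events of [history X t]; the past of time t is a measurable
    structure on Omega through this set. *)
Definition past_gen (t : R) : set (set Omega) :=
  [set A | exists u (B : set (borel E)),
         [/\ 0 <= u <= t, measurable B & A = X u @^-1` B]].

Notation past t := (g_sigma_algebraType (past_gen t)).

Lemma measurable_past_X (u t : R) : 0 <= u -> u <= t ->
  measurable_fun setT (X u : past t -> borel E).
Proof.
move=> u0 ut _ B mB; rewrite setTI.
by apply: sub_sigma_algebra; exists u, B; rewrite u0 ut.
Qed.

Lemma measurable_past_id (t : R) :
  measurable_fun setT (fun w : Omega => w : past t).
Proof.
move=> _ A mA; rewrite setTI preimage_id.
move: A mA; apply: smallest_sub; first exact: sigma_algebra_measurable.
move=> _ [u [B [/andP[u0 ut] mB ->]]].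
by rewrite -[X in measurable X]setTI; exact: measurable_X.
Qed.

Lemma past_mono (s t : R) (Z : Omega -> R) : s <= t ->
  measurable_fun setT (Z : past s -> R) -> measurable_fun setT (Z : past t -> R).
Proof.
move=> st mZ _ B mB; have := mZ measurableT B mB; rewrite !setTI.
move: (Z @^-1` B); apply: smallest_sub; first exact: smallest_sigma_algebra.
move=> _ [u [C [/andP[u0 us] mC ->]]].
by apply: sub_sigma_algebra; exists u, C; rewrite u0 (le_trans us).
Qed.

Section ge0.
Local Open Scope ereal_scope.

(** For a fixed event of the past both sides are integrals in f, and for a
    fixed f both sides are integrals in Z; the Markov property on events thus
    extends twice. *)
Lemma markov_ge0 x (s t : R) (Z : Omega -> R) (f : borel E -> R) :
  (0 <= s)%R -> (0 <= t)%R ->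
  measurable_fun setT (Z : past s -> R) -> (forall w, (0 <= Z w)%R) ->
  bmeas f -> (forall y, (0 <= f y)%R) ->
  \int[P x]_w ((Z w)%:E * (f (X (s + t) w))%:E) =
  \int[P x]_w ((Z w)%:E * \int[P (X s w)]_w' (f (X t w'))%:E).
Proof.
move=> s0 t0 mZ Z0 bf f0; have mf := bf.1.
have mst : measurable_fun setT (X (s + t)) by apply: measurable_X; exact: addr_ge0.
have ms : measurable_fun setT (X s) by exact: measurable_X.
have mt : measurable_fun setT (X t) by exact: measurable_X.
have nf : nnmeas (EFin \o f).
  by split; [exact/measurable_EFinP|move=> y; rewrite /= lee_fin].
have dP := daniell_integral (P x).
(* the case where Z is the indicator of an event of the past *)
have HA A : history X s A ->
    \int[P x]_w ((\1_A w)%:E * (f (X (s + t) w))%:E) =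
    \int[P x]_w ((\1_A w)%:E * \int[P (X s w)]_w' (f (X t w'))%:E).
  move=> hA; have mA : measurable A.
    by have := @measurable_past_id s measurableT A hA; rewrite setTI.
  have dA := daniell_weight (measurable_indic mA)
    (fun w => ler0n _ (w \in A)) dP.
  have d1 := daniell_comp mst dA.
  have d2 := daniell_comp mt (daniell_kernel P (daniell_comp ms dA)).
  apply: (daniell_ext d1 d2 _ nf) => B mB.
  have mB' u : (0 <= u)%R -> measurable (X u @^-1` B).
    by move=> u0; rewrite -[X in measurable X]setTI; exact: measurable_X.
  transitivity (P x (A `&` X (s + t) @^-1` B)).
    transitivity (\int[P x]_w (\1_(A `&` X (s + t) @^-1` B) w)%:E).
      by apply: eq_integral => w _; rewrite indicI /= EFinM.
    rewrite integral_indic ?setIT//; apply: measurableI => //.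
    by apply: mB'; exact: addr_ge0.
  rewrite (markov_property markovX)// integral_mkcond.
  apply: eq_integral => w _.
  rewrite /patch; case: ifPn => wA; last first.
    by rewrite indicE (negbTE wA) mul0e.
  rewrite indicE wA mul1e -[X in _ = X]/(\int[P (X s w)]_w' (\1_(X t @^-1` B) w')%:E).
  by rewrite integral_indic ?setIT//; exact: mB'.
have bK : bmeas (fun w => (\int[P (X s w)]_w' f (X t w'))%R).
  exact: (bmeas_comp ms (bmeas_kernel P (bmeas_comp mt bf))).
have K0 w : (0 <= \int[P (X s w)]_w' f (X t w'))%R.
  by apply: expect_ge0 => w'.
have bfst := bmeas_comp mst bf.
have d1 := daniell_comp (@measurable_past_id s) (daniell_weight bfst.1 (fun w => f0 _) dP).
have d2 := daniell_comp (@measurable_past_id s) (daniell_weight bK.1 K0 dP).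
have nZ : @nnmeas R _ (past s) (EFin \o Z).
  by split; [exact/measurable_EFinP|move=> w; rewrite /= lee_fin].
have KE w : (\int[P (X s w)]_w' f (X t w'))%R%:E = \int[P (X s w)]_w' (f (X t w'))%:E.
  exact: (expect_EFin (prob_kernel _) (bmeas_comp mt bf)).
under eq_integral do rewrite muleC.
under [RHS]eq_integral do rewrite -KE muleC.
apply: (daniell_ext d1 d2 _ nZ) => A hA.
have := HA A hA.
under eq_integral do rewrite muleC.
by under [RHS]eq_integral do rewrite -KE muleC.
Qed.

End ge0.

Lemma markov_past x (s t : R) (Z : Omega -> R) (f : borel E -> R) :
  0 <= s -> 0 <= t ->
  bmeas (Z : past s -> R) -> (forall w, 0 <= Z w) ->
  bmeas f -> (forall y, 0 <= f y) ->
  \int[P x]_w (Z w * f (X (s + t) w)) =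
  \int[P x]_w (Z w * \int[P (X s w)]_w' f (X t w')).
Proof.
move=> s0 t0 bZ Z0 bf f0.
have bZ' : bmeas Z := bmeas_comp (@measurable_past_id s) bZ.
have bt : bmeas (fun w => f (X t w)) := bmeas_comp (measurable_X t0) bf.
have bs := bmeas_comp (measurable_X s0) (bmeas_kernel P bt).
have bst := bmeas_comp (measurable_X (addr_ge0 s0 t0)) bf.
have P1 y := @prob_kernel _ _ _ _ _ P y.
apply: EFin_inj; rewrite (expect_EFin (P1 x) (bmeasM bZ' bst)).
rewrite (expect_EFin (P1 x) (bmeasM bZ' bs)).
under eq_integral do rewrite EFinM.
rewrite markov_ge0//; last exact: bZ.1.
by apply: eq_integral => w _; rewrite EFinM (expect_EFin (P1 _) bt).
Qed.

End markov.

(** * Continuity of translations in mean *)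

Section translation.
Context (R : realType).
Notation leb := (@lebesgue_measure R).
Local Open Scope ereal_scope.

Lemma measurable_shift (u : R) :
  measurable_fun setT (fun s : measurableTypeR R => (s + u)%R : measurableTypeR R).
Proof. exact: measurable_funD. Qed.

Lemma lebesgue_shift (u : R) (A : set (measurableTypeR R)) : measurable A ->
  leb A = pushforward leb (fun s : measurableTypeR R => (s + u)%R : measurableTypeR R) A.
Proof.
pose m : {measure set (measurableTypeR R) -> \bar R} :=
  measure_function_pushforward__canonical__measure_function_Measure leb (measurable_shift u).
apply: (@lebesgue_measure_unique _ m) => X /ocitvP[->|[[a b] /= ab ->]].
  by rewrite !measure0.
rewrite /m /= /pushforward.
have -> : (fun s : measurableTypeR R => (s + u)%R : measurableTypeR R) @^-1` `]a, b]%classic =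
   `](a - u)%R, (b - u)%R]%classic.
  by apply/seteqP; split => s /=; rewrite !in_itv/= ltrBlDr lerBrDr.
by rewrite !lebesgue_measure_itv/= !lte_fin ltrD2r ab -!EFinB; congr EFin; ring.
Qed.

Lemma ge0_integral_shift (u a b : R) (f : R -> \bar R) :
  measurable_fun setT f -> (forall s, 0 <= f s) ->
  \int[leb]_(s in `[a, b]) f (s + u)%R = \int[leb]_(s in `[(a + u)%R, (b + u)%R]) f s.
Proof.
move=> mf f0; have mI : measurable (`[(a + u)%R, (b + u)%R] : set (measurableTypeR R)).
  exact: measurable_itv.
pose m : {measure set (measurableTypeR R) -> \bar R} :=
  measure_function_pushforward__canonical__measure_function_Measure leb (measurable_shift u).
rewrite [RHS](_ : _ = \int[m]_(s in `[(a + u)%R, (b + u)%R]) f s); last first.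
  by apply: eq_measure_integral => A mA _; exact: lebesgue_shift.
rewrite (ge0_integral_pushforward (measurable_shift u))//; last first.
  exact: measurable_funTS.
congr (integral _ _ _).
by apply/seteqP; split => s /=; rewrite !in_itv/= !lerD2r.
Qed.

Local Close Scope ereal_scope.
Section finite_measure_on.
Context d (T : measurableType d) (m : {measure set T -> \bar R}) (D : set T).
Hypotheses (mD : measurable D) (Dy : (m D < +oo)%E).

Lemma bmeas_integrable_on (f : T -> R) : bmeas f -> m.-integrable D (EFin \o f).
Proof.
move=> [mf [M fM]]; apply: measurable_bounded_integrable => //.
  exact: measurable_funTS.
exists M; split; first exact: num_real.
by move=> N MN x _ /=; rewrite (le_trans (fM x))// ltW.
Qed.

Lemma Rintegral_EFin (f : T -> R) : bmeas f ->
  (\int[m]_(x in D) f x)%:E = (\int[m]_(x in D) (f x)%:E)%E.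
Proof.
move=> bf; rewrite /Rintegral fineK//.
exact: integrable_fin_num (bmeas_integrable_on bf).
Qed.

Lemma bounded_convergence (f_ : (T -> R)^nat) (f : T -> R) K :
  (forall n, bmeas (f_ n)) -> bmeas f -> (forall n x, `|f_ n x| <= K) ->
  (forall x, D x -> f_ ^~ x @ \oo --> f x) ->
  (fun n => \int[m]_(x in D) f_ n x) @ \oo --> \int[m]_(x in D) f x.
Proof.
move=> bf_ bf f_K cvf.
suff : (\int[m]_(x in D) (f_ n x)%:E)%E @[n --> \oo] --> (\int[m]_(x in D) f x)%:E.
  by move=> /fine_cvgP[_].
rewrite Rintegral_EFin//.
apply: (dominated_cvg mD (g := fun=> K%:E)) => //.
- by move=> n; apply/measurable_EFinP/measurable_funTS; case: (bf_ n).
- by move=> x Dx; apply: cvg_EFin; [exact: nearW|exact: cvf].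
- exact: (bmeas_integrable_on (bmeas_cst T K)).
- by move=> n x Dx; rewrite /= lee_fin.
Qed.

End finite_measure_on.

Definition clamp (K x : R) := Num.max (- K) (Num.min K x).

Lemma clamp_norm K x : 0 <= K -> `|clamp K x| <= K.
Proof.
move=> K0; rewrite /clamp ler_norml le_max lexx/= ge_max ge_min lexx/= andbT.
by rewrite (le_trans _ K0)// oppr_le0.
Qed.

Lemma clamp_dist K x y : `|y| <= K -> `|y - clamp K x| <= `|y - x|.
Proof.
rewrite ler_norml => /andP[yK1 yK2]; rewrite /clamp /Num.max /Num.min.
case: (ltP K x) => xK; case: ltP => xK'.
- by rewrite !ler0_norm; lra.
- by rewrite ler_norml; apply/andP; split; have := ler_norm (y-x);
  have := ler_norm (-(y-x)); rewrite normrN; lra.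
- by [].
- rewrite ler_norml; apply/andP; split; have := ler_norm (y-x);
  have := ler_norm (-(y-x)); rewrite normrN; lra.
Qed.

Lemma continuous_clamp K : continuous (clamp K).
Proof.
move=> x; have H : {for x, continuous ((cst K : R -> R^o) \min id)}.
  by apply: continuous_min; [exact: cst_continuous|exact: cvg_id].
by apply: (@continuous_max _ _ (cst (- K)) _ x _ H); exact: cst_continuous.
Qed.

(** Approximate g in mean by a continuous function, to which bounded
    convergence applies.  Clamping the approximation to [- K, K] keeps it bounded
    and does not increase its distance to g. *)
Lemma translation_L1 (K : R) (g : measurableTypeR R -> R) (u : R^nat) :
  measurable_fun setT g -> (forall s, `|g s| <= K) ->
  (forall n, 0 <= u n) -> u @ \oo --> 0 ->
  (fun n => \int[leb]_(s in `[0, 1]) `|g (s + u n) - g s|) @ \oo --> 0.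
Proof.
move=> mg gK u0 ucvg; have K0 : 0 <= K by exact: le_trans (gK 0).
(* On [0, 2] the approximation remains valid after a shift by u n <= 1. *)
pose D02 : set (measurableTypeR R) := `[0, 2]%classic.
pose D01 : set (measurableTypeR R) := `[0, 1]%classic.
have mD02 : measurable D02 by exact: measurable_itv.
have mD01 : measurable D01 by exact: measurable_itv.
have D02y : (leb D02 < +oo)%E by rewrite lebesgue_measure_itv/=; case: ifP => _; rewrite ?ltry.
have D01y : (leb D01 < +oo)%E by rewrite lebesgue_measure_itv/=; case: ifP => _; rewrite ?ltry.
have bg : bmeas g by split => //; exists K.
have ig := bmeas_integrable_on mD02 D02y bg.
have [phi_ [cphi iphi cvphi]] := approximation_continuous_integrable mD02 D02y ig.
apply/cvgrPdist_le => e e0.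
have e3 : 0 < e / 3 by rewrite divr_gt0.
have [N gphi] : exists N, (\int[leb]_(z in D02) `|(g z - phi_ N z)%:E| <= (e / 3)%:E)%E.
  have /fine_cvgP[H1 /cvgr0_norm_lt/(_ _ e3) H2] := cvphi.
  near \oo => N; exists N; rewrite -[leLHS]fineK; last by near: N.
  by rewrite lee_fin (le_trans (ler_norm _))// ltW//; near: N.
pose phi (x : R) := clamp K (phi_ N x).
have phiK x : `|phi x| <= K by exact: clamp_norm.
have cphiN : continuous phi.
  move=> x; apply: (cvg_comp (phi_ N) (clamp K)); first exact: (cphi N x).
  exact: continuous_clamp.
have bphi : bmeas (phi : measurableTypeR R -> R).
  by split; [exact: continuous_measurable_fun|exists K].
have ms v := @measurable_shift v.
have bgp : bmeas (fun x => `|g x - phi x|) by exact/bmeas_norm/bmeasB.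
have gphi2 : \int[leb]_(z in D02) `|g z - phi z| <= e / 3.
  rewrite -lee_fin (Rintegral_EFin mD02 D02y bgp) (le_trans _ gphi)//.
  apply: ge0_le_integral => //.
  - by apply/measurable_EFinP/measurable_funTS; case: bgp.
  - apply/measurable_EFinP; apply: measurableT_comp => //.
    apply: measurable_funTS; apply: measurable_funB => //.
    exact: continuous_measurable_fun.
  - by move=> s _; rewrite lee_fin clamp_dist.
have bs (v : R) (f : measurableTypeR R -> R) :
    bmeas f -> bmeas (fun s : measurableTypeR R => f (s + v)).
  exact: bmeas_comp (ms v).
have cvb : (fun n => \int[leb]_(s in D01) `|phi (s + u n) - phi s|) @ \oo --> (0 : R).
  rewrite -[X in _ --> X](_ : \int[leb]_(s in D01) (0:R) = 0); last first.
    by rewrite Rintegral_cst// mul0r.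
  apply: (bounded_convergence mD01 D01y (K := K + K)).
  - by move=> n; apply/bmeas_norm/bmeasB => //; exact: bs.
  - exact: bmeas_cst.
  - by move=> n s; rewrite normr_id (le_trans (ler_normB _ _))// lerD.
  - move=> s _; rewrite -(normr0 R) -[X in `|X|](subrr (phi s)).
    apply: cvg_norm; apply: cvgB; last exact: cvg_cst.
    apply: (cvg_comp _ phi _ (cphiN (s : R))).
    have := cvgD (cvg_cst (s : R) (F := \oo)) ucvg; rewrite addr0 => h. exact: h.
have shift_le n : u n <= 1 -> \int[leb]_(s in D01) `|g (s + u n) - phi (s + u n)| <= e / 3.
  move=> un1; apply: le_trans gphi2.
  rewrite -lee_fin (Rintegral_EFin mD01 D01y (bs (u n) _ bgp)) (Rintegral_EFin mD02 D02y bgp).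
  rewrite (@ge0_integral_shift (u n) 0 1 (fun s => `|g s - phi s|%:E)); last 2 first.
  - by apply/measurable_EFinP; case: bgp.
  - by move=> s; rewrite lee_fin.
  apply: ge0_subset_integral => //.
    by apply/measurable_EFinP/measurable_funTS; case: bgp.
  move=> s /=; rewrite /D02/= !in_itv/= add0r => /andP[us s1].
  by rewrite (le_trans (u0 n) us) (le_trans s1)// lerD2l.
have last_le : \int[leb]_(s in D01) `|phi s - g s| <= e / 3.
  apply: le_trans gphi2; under eq_Rintegral do rewrite distrC.
  rewrite -lee_fin (Rintegral_EFin mD01 D01y bgp) (Rintegral_EFin mD02 D02y bgp).
  apply: ge0_subset_integral => //.
    by apply/measurable_EFinP/measurable_funTS; case: bgp.
  move=> s; rewrite /D01 /D02 /= !in_itv/= => /andP[-> s1] /=.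
  by rewrite (le_trans s1)// ler1n.
have b1 n := bs (u n) _ bgp.
have b2 n : bmeas (fun s : measurableTypeR R => `|phi (s + u n) - phi s|) by
  apply/bmeas_norm/bmeasB => //; exact: bs.
have b3 : bmeas (fun s : measurableTypeR R => `|phi s - g s|) by exact/bmeas_norm/bmeasB.
near=> n.
rewrite sub0r normrN ger0_norm; last by apply: Rintegral_ge0.
apply: (@le_trans _ _ (\int[leb]_(s in D01) (`|g (s + u n) - phi (s + u n)| +
   `|phi (s + u n) - phi s| + `|phi s - g s|))).
  apply: le_Rintegral => //.
  - by apply: (bmeas_integrable_on mD01 D01y); apply/bmeas_norm/bmeasB => //; exact: bs.
  - apply: (bmeas_integrable_on mD01 D01y); apply: bmeasD => //; exact: bmeasD (b1 n) (b2 n).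
  - move=> s _; have -> : g (s + u n) - g s = (g (s + u n) - phi (s + u n)) +
      (phi (s + u n) - phi s) + (phi s - g s) by ring.
    by rewrite (le_trans (ler_normD _ _))// lerD2r ler_normD.
have ion f := @bmeas_integrable_on _ _ leb _ mD01 D01y f.
rewrite (RintegralD mD01 (ion _ (bmeasD (b1 n) (b2 n))) (ion _ b3)).
rewrite (RintegralD mD01 (ion _ (b1 n)) (ion _ (b2 n))).
have h1 : u n <= 1.
  near: n; have /cvgr0_norm_le/(_ _ ltr01) := ucvg; apply: filterS => n.
  by apply: le_trans; exact: ler_norm.
have h2 : \int[leb]_(s in D01) `|phi (s + u n) - phi s| <= e / 3.
  near: n; have /cvgr0_norm_le/(_ _ e3) := cvb; apply: filterS => n.
  by apply: le_trans; exact: ler_norm.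
have -> : e = e / 3 + e / 3 + e / 3 by field.
by apply: lerD => //; apply: lerD => //; exact: shift_le.
Unshelve. all: by end_near. Qed.

End translation.

(** * Fubini's theorem in the time variable *)

Section fubini_time.
Context (R : realType) d (T : measurableType d) (m : probability T R).
Notation leb := (@lebesgue_measure R).
Variables (D : set (measurableTypeR R)) (f : measurableTypeR R * T -> R).
Hypotheses (mD : measurable D) (Dy : (leb D < +oo)%E).
Hypotheses (bf : bmeas f) (f0 : forall p, 0 <= f p).

Let F (p : measurableTypeR R * T) : \bar R := (f p * \1_D p.1)%:E.

Let F0 p : (0 <= F p)%E.
Proof. by rewrite lee_fin mulr_ge0. Qed.

Let mF : measurable_fun setT F.
Proof.
apply/measurable_EFinP; apply: measurable_funM; first exact: bf.1.
by apply: (measurableT_comp (measurable_indic mD)); exact: measurable_fst.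
Qed.

Lemma bmeas_pair1 s : bmeas (fun w => f (s, w)).
Proof. by apply: (bmeas_comp _ bf); exact: pair1_measurable. Qed.

Lemma bmeas_pair2 w : bmeas (fun s => f (s, w)).
Proof. by apply: (bmeas_comp _ bf); exact: pair2_measurable. Qed.

Let int_time w : (\int[leb]_s F (s, w) = (\int[leb]_(s in D) f (s, w))%:E)%E.
Proof.
rewrite (Rintegral_EFin mD Dy (bmeas_pair2 w)) [RHS]integral_mkcond.
apply: eq_integral => s _; rewrite /patch /F/= indicE.
by case: ifP => sD; rewrite ?mulr1 ?mulr0.
Qed.

Lemma bmeas_time_integral : bmeas (fun w => \int[leb]_(s in D) f (s, w)).
Proof.
have [_ [M fM]] := bf.
apply: (@bmeas_bounded _ _ _ _ (M * fine (leb D))).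
  have := @measurable_fun_fubini_tonelli_G _ _ _ _ _ leb _ mF F0.
  by rewrite /fubini_G; under eq_fun do rewrite int_time; move/measurable_EFinP.
move=> w; rewrite (le_trans (le_normr_Rintegral _ _))//.
  exact: bmeas_integrable_on (bmeas_pair2 w).
rewrite -Rintegral_cst//; apply: le_Rintegral => //.
- exact: (bmeas_integrable_on mD Dy (bmeas_norm (bmeas_pair2 w))).
- exact: (bmeas_integrable_on mD Dy (bmeas_cst _ M)).
Qed.

Lemma bmeas_space_integral : bmeas (fun s => \int[m]_w f (s, w)).
Proof.
have [_ [M fM]] := bf; have m1 := @probability_setT _ _ _ m.
apply: (@bmeas_bounded _ _ _ _ M); last first.
  by move=> s; apply: (expect_norm_le m1 (bmeas_pair1 s)).
have f0' p : (0 <= (f p)%:E)%E by rewrite lee_fin.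
have mf : measurable_fun setT (EFin \o f) by apply/measurable_EFinP; case: bf.
have := @measurable_fun_fubini_tonelli_F _ _ _ _ _ m _ mf f0'.
rewrite /fubini_F; under eq_fun do rewrite -(expect_EFin m1 (bmeas_pair1 _)).
by move/measurable_EFinP.
Qed.

Lemma fubini_time :
  \int[m]_w \int[leb]_(s in D) f (s, w) = \int[leb]_(s in D) \int[m]_w f (s, w).
Proof.
have m1 := @probability_setT _ _ _ m.
apply: EFin_inj; rewrite (expect_EFin m1 bmeas_time_integral).
rewrite (Rintegral_EFin mD Dy bmeas_space_integral).
under eq_integral do rewrite -int_time.
rewrite -(@fubini_tonelli _ _ _ _ _ leb m _ mF F0) [RHS]integral_mkcond.
apply: eq_integral => s _; rewrite /patch.
case: ifP => sD.
  rewrite (expect_EFin m1 (bmeas_pair1 s)); apply: eq_integral => w _.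
  by rewrite /F/= indicE sD mulr1.
by apply: integral0_eq => w _; rewrite /F/= indicE sD mulr0.
Qed.

End fubini_time.

(** * Stationarity and mean continuity *)

Section stationary.
Context (R : realType) (E : ptopologicalType) (dO : measure_display)
  (Omega : measurableType dO) (X : R -> Omega -> borel E)
  (P : R.-pker (borel E) ~> Omega) (mu : probability (borel E) R).
Hypotheses (markovX : markov_process X P) (mu_inv : invariant_measure X P mu).
Notation leb := (@lebesgue_measure R).
Notation Pmu := (law_from P mu).
Let mX u (u0 : 0 <= u) := measurable_X markovX u0.
Let Pmu1 := law_setT P mu.
Let mu1 := @probability_setT _ _ _ mu.
Let P1 y := @prob_kernel _ _ _ _ _ P y.

Lemma invariant_expect (t : R) (f : borel E -> R) : 0 <= t -> bmeas f ->
  (forall y, 0 <= f y) -> \int[Pmu]_w f (X t w) = \int[mu]_y f y.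
Proof.
move=> t0 bf f0; have bft := bmeas_comp (mX t0) bf.
apply: EFin_inj; rewrite (expect_EFin Pmu1 bft) (expect_EFin mu1 bf).
have nf : nnmeas (EFin \o f).
  by split; [apply/measurable_EFinP; case: bf|move=> y /=; rewrite lee_fin].
have d1 := daniell_comp (mX t0) (daniell_integral Pmu).
apply: (daniell_ext d1 (daniell_integral mu) _ nf) => B mB.
have mB' : measurable (X t @^-1` B) by rewrite -[X in measurable X]setTI; exact: mX.
rewrite (_ : (\int[Pmu]_x _)%E = (\int[Pmu]_w (\1_(X t @^-1` B) w)%:E)%E)//.
by rewrite !integral_indic// !setIT; exact: mu_inv.
Qed.

(** The right-hand side is free of s: started from mu, the law of the pair
    (X_s, X_(s+t)) is stationary. *)
Lemma pair_expect (s t : R) (f g : borel E -> R) : 0 <= s -> 0 <= t ->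
  bmeas f -> (forall y, 0 <= f y) -> bmeas g -> (forall y, 0 <= g y) ->
  \int[Pmu]_w (f (X s w) * g (X (s + t) w)) =
  \int[mu]_y (f y * \int[P y]_w g (X t w)).
Proof.
move=> s0 t0 bf f0 bg g0.
have bgt := bmeas_comp (mX t0) bg.
have bst := bmeas_comp (mX (addr_ge0 s0 t0)) bg.
have bfs := bmeas_comp (mX s0) bf.
have bfK := bmeasM bf (bmeas_kernel P bgt).
rewrite expect_law; last exact: bmeasM.
have bfp : @bmeas R _ (g_sigma_algebraType (past_gen X s)) (fun w => f (X s w)).
  exact: (bmeas_comp (@measurable_past_X _ _ _ _ X s s s0 (lexx s)) bf).
have f0' w : 0 <= f (X s w) by [].
under eq_Rintegral do rewrite (markov_past markovX _ s0 t0 bfp f0' bg g0).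
rewrite -expect_law; last exact: (bmeas_comp (mX s0) bfK).
by rewrite (invariant_expect s0 bfK)// => y; rewrite mulr_ge0// expect_ge0.
Qed.

Variable W : borel E -> R.
Hypotheses (bW : bmeas W) (W0 : forall y, 0 <= W y).

Lemma stationary_sqr (s t : R) : 0 <= s -> 0 <= t ->
  \int[Pmu]_w (W (X (s + t) w) - W (X s w)) ^+ 2 =
  \int[Pmu]_w (W (X t w) - W (X 0 w)) ^+ 2.
Proof.
suff H r : 0 <= r -> 0 <= t -> \int[Pmu]_w (W (X (r + t) w) - W (X r w)) ^+ 2 =
    2 * \int[mu]_y (W y ^+ 2) - 2 * \int[mu]_y (W y * \int[P y]_w W (X t w)).
  by move=> s0 t0; rewrite H// -[in RHS](add0r t) H.
move=> r0 t0.
have brt := bmeas_comp (mX (addr_ge0 r0 t0)) bW.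
have br := bmeas_comp (mX r0) bW.
transitivity (\int[Pmu]_w (W (X (r + t) w) ^+ 2 + W (X r w) ^+ 2 -
    2 * (W (X r w) * W (X (r + t) w)))).
  by apply: expect_eq => w; ring.
rewrite (expectB Pmu1 (bmeasD (bmeasX 2 brt) (bmeasX 2 br)) (bmeasZ 2 (bmeasM br brt))).
rewrite (expectD Pmu1 (bmeasX 2 brt) (bmeasX 2 br)).
rewrite (expectZ Pmu1 2 (bmeasM br brt)) (pair_expect r0 t0)//.
have W20 y : 0 <= W y ^+ 2 by exact: sqr_ge0.
rewrite (invariant_expect (addr_ge0 r0 t0) (bmeasX 2 bW) W20).
rewrite (invariant_expect r0 (bmeasX 2 bW) W20).
by rewrite !mulr_natl !mulr2n.
Qed.

Definition path_fun (p : measurableTypeR R * Omega) : R := W (X `|p.1| p.2).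

Lemma bmeas_path_fun : bmeas path_fun.
Proof. exact: bmeas_comp (measurable_path markovX) bW. Qed.

(** A stationary and jointly measurable process is continuous in mean.  By
    stationarity the expectation is its own average over the starting time s in
    [0, 1]; along each path the average of |W (X_(s+h)) - W (X_s)| tends to 0
    with h because translations are continuous in mean. *)
Lemma increment_sqr_cvg (u : R^nat) : (forall n, 0 <= u n) -> u @ \oo --> 0 ->
  (fun n => \int[Pmu]_w (W (X (u n) w) - W (X 0 w)) ^+ 2) @ \oo --> 0.
Proof.
move=> u0 ucvg.
have [K WK] := bW.2; have K0 : 0 <= K by exact: le_trans (WK point).
pose D : set (measurableTypeR R) := `[0, 1]%classic.
have mD : measurable D by exact: measurable_itv.
have D1 : leb D = 1%E by rewrite lebesgue_measure_itv/= lte_fin ltr01 -EFinB subr0.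
have Dy : (leb D < +oo)%E by rewrite D1 ltry.
pose f n (p : measurableTypeR R * Omega) := `|path_fun (p.1 + u n : R, p.2) - path_fun p|.
have bf n : bmeas (f n).
  apply/bmeas_norm/bmeasB; last exact: bmeas_path_fun.
  apply: (bmeas_comp _ bmeas_path_fun).
  apply/measurable_fun_pairP; split; last exact: measurable_snd.
  exact: (measurableT_comp (@measurable_shift R (u n)) measurable_fst).
have f0 n p : 0 <= f n p by exact: normr_ge0.
have fK n p : f n p <= K + K by rewrite (le_trans (ler_normB _ _))// lerD// WK.
have bound n : \int[Pmu]_w (W (X (u n) w) - W (X 0 w)) ^+ 2 <=
    (K + K) * \int[Pmu]_w \int[leb]_(s in D) f n (s, w).
  rewrite (fubini_time Pmu mD Dy (bf n) (f0 n)).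
  have bsp := bmeas_space_integral Pmu (bf n) (f0 n).
  rewrite -RintegralZl//; last exact: bmeas_integrable_on.
  rewrite -[leLHS]mulr1 -[X in _ * X]/(fine 1%:E) -D1 -Rintegral_cst//.
  apply: le_Rintegral => //.
  - exact: (bmeas_integrable_on mD Dy (bmeas_cst _ _)).
  - exact: (bmeas_integrable_on mD Dy (bmeasZ (K+K) bsp)).
  move=> s; rewrite /D /= in_itv/= => /andP[s0 _].
  have s1 : 0 <= s + u n by rewrite addr_ge0.
  have bd := bmeasB (bmeas_comp (mX s1) bW) (bmeas_comp (mX s0) bW).
  rewrite -(stationary_sqr s0 (u0 n)) -(expectZ Pmu1 _ (bmeas_pair1 (bf n) s)).
  apply: (expect_le Pmu1); first exact: (bmeasX 2 bd).
    exact: bmeasZ (bmeas_pair1 (bf n) s).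
  move=> w; rewrite /f /path_fun/= (ger0_norm s0) (ger0_norm s1).
  rewrite -[leLHS]real_normK ?num_real// expr2 ler_wpM2r//.
  by rewrite (le_trans (ler_normB _ _))// lerD.
have cvf : (fun n => \int[Pmu]_w \int[leb]_(s in D) f n (s, w)) @ \oo -->
    \int[Pmu]_w (0 : R).
  have PTy : (Pmu setT < +oo)%E by rewrite Pmu1 ltry.
  apply: (bounded_convergence measurableT PTy (K := K + K)).
  - by move=> n; exact: bmeas_time_integral.
  - exact: bmeas_cst.
  - move=> n w; rewrite ger0_norm ?Rintegral_ge0//.
    rewrite -[leRHS]mulr1 -[X in _ * X]/(fine 1%:E) -D1 -Rintegral_cst//.
    apply: le_Rintegral => //.
    + exact: (bmeas_integrable_on mD Dy (bmeas_pair2 (bf n) w)).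
    + exact: (bmeas_integrable_on mD Dy (bmeas_cst _ _)).
  - move=> w _; have := @translation_L1 R K (fun s => path_fun (s, w)) u.
    apply => //; first exact: (bmeas_pair2 bmeas_path_fun w).1.
    by move=> s; exact: WK.
rewrite expect_cst in cvf => //.
have cv2 : (fun n => (K + K) * \int[Pmu]_w \int[leb]_(s in D) f n (s, w)) @ \oo -->
  (K + K) * 0 by apply: cvgM => //; exact: cvg_cst.
rewrite mulr0 in cv2; apply: squeeze_cvgr (cvg_cst (0 : R)) cv2.
by apply: nearW => n; rewrite bound andbT expect_ge0// => w; exact: sqr_ge0.
Qed.

End stationary.

(** * Auxiliary inequalities for exponentials and iterations *)

Lemma expR_lipschitz (R : realType) (M a b : R) : a <= M -> b <= M ->
  `|expR a - expR b| <= expR M * `|a - b|.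
Proof.
wlog ab : a b / b <= a => [H|aM bM].
  case: (leP b a) => [|/ltW] ab aM bM; first exact: H.
  by rewrite distrC (distrC a) H.
rewrite !ger0_norm ?subr_ge0 ?ler_expR//.
apply: (@le_trans _ _ (expR a * (a - b))); last first.
  by rewrite ler_wpM2r ?subr_ge0// ler_expR.
have -> : expR b = expR a * expR (b - a) by rewrite -expRD addrC subrK.
rewrite -{1}(mulr1 (expR a)) -mulrBr ler_wpM2l ?expR_ge0//.
have := expR_ge1Dx (b - a); lra.
Qed.

(** Iterate the one-step estimate n times with h = T / n: the errors h e
    add up to T e, and e is arbitrary. *)
Lemma discrete_gronwall (R : realType) (N : R -> R) (c T : R) : 0 <= c -> 0 <= T ->
  (forall t, 0 <= N t) ->
  (forall e, 0 < e -> exists2 d, 0 < d & forall t h, 0 <= t -> t <= T ->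
     0 <= h -> h < d -> N (t + h) <= N t + h * (c * N t) + h * e) ->
  N 0 <= 1 -> N T <= expR (c * T).
Proof.
move=> c0 T0 Nge0 HN N0.
suff H e : 0 < e -> N T <= expR (c * T) * (1 + T * e).
  apply/ler_addgt0Pr => e e0.
  pose b := expR (c * T) * T + 1.
  have b0 : 0 < b by rewrite ltr_wpDl// mulr_ge0// expR_ge0.
  apply: (le_trans (H _ (divr_gt0 e0 b0))).
  rewrite mulrDr mulr1 lerD2l mulrA mulrCA -[leRHS]mulr1; apply: ler_wpM2l; first exact: ltW.
  by rewrite ler_pdivrMr// mul1r lerDl.
move=> e0; have [d d0 Hd] := HN e e0.
have [n tn] : exists n : nat, T / n.+1%:R < d.
  have := archi_boundP (divr_ge0 T0 (ltW d0)); set n := Num.bound _ => tn.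
  exists n; rewrite ltr_pdivrMr ?ltr0n// mulrC -ltr_pdivrMr//.
  by rewrite (lt_trans tn)// ltr_nat.
pose h := T / n.+1%:R; have h0 : 0 <= h by rewrite divr_ge0.
have nh : n.+1%:R * h = T by rewrite /h mulrC divfK// pnatr_eq0.
have step k : (k <= n.+1)%N -> N (k%:R * h) <= expR (c * (k%:R * h)) * (1 + k%:R * h * e).
  elim: k => [_|k IH kn]; first by rewrite !mul0r mulr0 expR0 mul1r addr0.
  have kh0 : 0 <= k%:R * h by rewrite mulr_ge0.
  have khT : k%:R * h <= T by rewrite -nh ler_wpM2r// ler_nat ltnW.
  have := Hd _ h kh0 khT h0 tn; rewrite -natr1 mulrDl mul1r => /le_trans; apply.
  have := IH (ltnW kn); have Nk := Nge0 (k%:R * h).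
  have e1 : 1 <= expR (c * (k%:R * h + h)) by rewrite (le_trans _ (expR_ge1Dx _))//
    lerDl mulr_ge0// addr_ge0.
  have e2 : 1 + c * h <= expR (c * h) by exact: expR_ge1Dx.
  have ch : 0 <= 1 + c * h by rewrite addr_ge0// mulr_ge0.
  have he : 0 <= h * e by rewrite mulr_ge0// ltW.
  have ke : 0 <= 1 + k%:R * h * e by rewrite addr_ge0// mulr_ge0// ltW.
  have E0 := expR_ge0 (c * (k%:R * h)).
  rewrite mulrDr expRD in e1 *.
  move: (expR (c * (k%:R * h))) (expR (c * h)) (N (k%:R * h)) e1 e2 E0 Nk => E' F'
    n' e1 e2 E0 Nk nk.
  apply: (@le_trans _ _ (n' * (1 + c * h) + h * e)); first by rewrite le_eqVlt;
    apply/orP; left; apply/eqP; ring.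
  apply: (@le_trans _ _ (E' * (1 + k%:R * h * e) * F' + E' * F' * (h * e))).
    apply: lerD; first by apply: ler_pM.
    by rewrite -[leLHS]mul1r ler_wpM2r.
  by rewrite le_eqVlt; apply/orP; left; apply/eqP; ring.
by have := step n.+1 (leqnn _); rewrite nh.
Qed.

Lemma sqr_increment_le (R : realType) (a b h k r M C : R) : 0 <= b -> b <= M ->
  a - b = h * k + r -> (a - b) ^+ 2 <= C ->
  a ^+ 2 <= b ^+ 2 + 2 * h * (b * k) + 2 * M * `|r| + C.
Proof.
move=> b0 bM ab abC.
have -> : a ^+ 2 = b ^+ 2 + 2 * b * (a - b) + (a - b) ^+ 2 by ring.
apply: lerD => //; rewrite {}ab.
have -> : b ^+ 2 + 2 * b * (h * k + r) = b ^+ 2 + 2 * h * (b * k) + 2 * (b * r).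
  by ring.
rewrite lerD2l -mulrA ler_wpM2l// (@le_trans _ _ (b * `|r|))//.
  by rewrite ler_wpM2l// ler_norm.
by rewrite ler_wpM2r.
Qed.

Section bounded_L2.
Context (R : realType) d (T : measurableType d) (m : {measure set T -> \bar R}).
Hypothesis m1 : m setT = 1%E.

Lemma Lnorm2_bmeas (f : T -> R) : bmeas f ->
  Lnorm m 2%:E (EFin \o f) = (Num.sqrt (\int[m]_x (f x ^+ 2)))%:E.
Proof.
move=> bf; rewrite unlock /=.
under eq_integral => x _ do rewrite /= powR_mulrn// real_normK ?num_real//.
rewrite -(expect_EFin m1 (bmeasX 2 bf)) poweR_EFin powR12_sqrt//.
by apply: expect_ge0 => x; exact: sqr_ge0.
Qed.

Lemma bmeas_Lfun2 (f : T -> R) : bmeas f -> f \in Lfun m 2%:E.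
Proof.
move=> bf; rewrite inE; apply/andP; split; rewrite inE/=; first exact: bf.1.
by rewrite /finite_norm (Lnorm2_bmeas bf) ltry.
Qed.

End bounded_L2.

(** * The Feynman-Kac function of a bounded potential *)

Section feynman_kac.
Context (R : realType) (E : ptopologicalType) (dO : measure_display)
  (Omega : measurableType dO) (X : R -> Omega -> borel E)
  (P : R.-pker (borel E) ~> Omega) (mu : probability (borel E) R).
Hypotheses (polishE : polish R E) (markovX : markov_process X P)
  (mu_inv : invariant_measure X P mu).
Variables (W : borel E -> R) (K : R).
Hypotheses (mW : measurable_fun setT W) (W0 : forall y, 0 <= W y)
  (WK : forall y, W y <= K).
Notation leb := (@lebesgue_measure R).
Notation Pmu := (law_from P mu).
Let mX u (u0 : 0 <= u) := measurable_X markovX u0.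
Let Pmu1 := law_setT P mu.
Let mu1 := @probability_setT _ _ _ mu.
Let P1 y := @prob_kernel _ _ _ _ _ P y.

Let bW : bmeas W := bmeas_ge0_le mW W0 WK.

Let bX s (s0 : 0 <= s) := bmeas_comp (mX s0) bW.

Let K0 : 0 <= K. Proof. by apply: le_trans (WK point). Qed.

(** Mean continuity as a modulus, uniform in s by stationarity.  The passage
    from the mean square to the mean is |x| <= a + x^2 / a with a = e / 2. *)
Lemma increment_modulus e : 0 < e -> exists2 d, 0 < d &
  forall s h, 0 <= s -> 0 <= h -> h < d ->
    \int[Pmu]_w `|W (X (s + h) w) - W (X s w)| <= e.
Proof.
move=> e0; pose eta h := \int[Pmu]_w (W (X h w) - W (X 0 w)) ^+ 2.
have e2 : 0 < e / 2 by rewrite divr_gt0.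
have [d d0 Hd] : exists2 d, 0 < d & forall h, 0 <= h -> h < d -> eta h <= (e / 2) ^+ 2.
  apply: contrapT => nd.
  have /choice[u Hu] : forall n : nat, exists h,
      [/\ 0 <= h, h < n.+1%:R^-1 & (e / 2) ^+ 2 < eta h].
    move=> n; apply: contrapT => nh; apply: nd.
    exists n.+1%:R^-1; first by rewrite invr_gt0 ltr0n.
    move=> h h0 hn; rewrite leNgt; apply/negP => eh; apply: nh.
    by exists h.
  have u0 n : 0 <= u n by have [] := Hu n.
  have ucvg : u @ \oo --> 0.
    apply: (squeeze_cvgr _ (cvg_cst 0) (@cvg_harmonic R)).
    by apply: nearW => n; rewrite u0 ltW//; have [] := Hu n.
  have := increment_sqr_cvg markovX mu_inv bW W0 u0 ucvg.
  move/cvgr0_norm_lt => /(_ ((e / 2) ^+ 2) (exprn_gt0 _ e2)) [N _ HN].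
  have [_ _] := Hu N; rewrite ltNge => /negP; apply.
  by have := HN N (leqnn _); rewrite /= => /ltW; apply: le_trans; exact: ler_norm.
exists d => // s h s0 h0 hd.
have sh0 := addr_ge0 s0 h0.
have bd : bmeas (fun w => W (X (s + h) w) - W (X s w)).
  exact: bmeasB (bmeas_comp (mX sh0) bW) (bmeas_comp (mX s0) bW).
have bsq := bmeasZ (e / 2)^-1 (bmeasX 2 bd).
apply: (@le_trans _ _ (\int[Pmu]_w (e / 2 + (e / 2)^-1 * (W (X (s + h) w) - W (X s w)) ^+ 2))).
  apply: (expect_le Pmu1 (bmeas_norm bd) (bmeasD (bmeas_cst _ _) bsq)) => w.
  move: (W _ - W _) => x; rewrite -[in leRHS]real_normK ?num_real//.
  have x0 := normr_ge0 x; move: `|x| x0 => {}x x0.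
  have [xe|xe] := leP x (e / 2).
    by rewrite (le_trans xe)// lerDl mulr_ge0 ?invr_ge0 ?sqr_ge0// ltW.
  have h1 : x <= (e / 2)^-1 * x ^+ 2 by rewrite mulrC ler_pdivlMr// expr2 ler_wpM2l// ltW.
  by rewrite (le_trans h1)// lerDr ltW.
rewrite (expectD Pmu1 (bmeas_cst _ _) bsq) (expect_cst Pmu1) (expectZ Pmu1 _ (bmeasX 2 bd)).
rewrite (stationary_sqr markovX mu_inv bW W0 s0 h0) [leRHS]splitr lerD2l.
by rewrite ler_pdivrMl// -expr2; exact: Hd.
Qed.

Definition time_integral (a b : R) (w : Omega) : R :=
  \int[leb]_(r in `[a, b]) path_fun X W (r, w).

Let mI a b : measurable (`[a, b]%classic : set (measurableTypeR R)).
Proof. exact: measurable_itv. Qed.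

Let Iy a b : (leb `[a, b]%classic < +oo)%E.
Proof. by rewrite lebesgue_measure_itv/=; case: ifP => _; rewrite ?ltry. Qed.

Let bY := bmeas_path_fun markovX bW.

Lemma bmeas_time a b : bmeas (time_integral a b).
Proof. by apply: (bmeas_time_integral (mI a b) (Iy a b) bY) => p; exact: W0. Qed.

Lemma time_integral_ge0 a b w : 0 <= time_integral a b w.
Proof. by apply: Rintegral_ge0 => r _; exact: W0. Qed.

Lemma fine_leb a b : a <= b -> fine (leb `[a, b]%classic) = b - a.
Proof.
move=> ab; rewrite lebesgue_measure_itv/= lte_fin.
have [//|ba] := ltP a b; have -> : a = b by apply/eqP; rewrite eq_le ab.
by rewrite subrr.
Qed.

Lemma time_integral_le a b w : a <= b -> time_integral a b w <= K * (b - a).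
Proof.
move=> ab; rewrite -(fine_leb ab) -Rintegral_cst//.
apply: le_Rintegral => //; first exact: (bmeas_integrable_on (mI a b) (Iy a b) (bmeas_pair2 bY w)).
  exact: (bmeas_integrable_on (mI a b) (Iy a b) (bmeas_cst _ _)).
by move=> r _; exact: WK.
Qed.

Lemma time_integral_cat a b c w : a <= b -> b <= c ->
  time_integral a c w = time_integral a b w + time_integral b c w.
Proof.
move=> ab bc; rewrite /time_integral.
have i := bmeas_integrable_on (mI a c) (Iy a c) (bmeas_pair2 bY w).
have := Rintegral_itvB i (x := b); rewrite !bnd_simp => /(_ ab bc).
rewrite Rintegral_itv_obnd_cbnd; last first.
  apply: (integrableS (mI a c) _ _ i); first exact: measurable_itv.
  by move=> r /=; rewrite !in_itv/= => /andP[br ->]; rewrite (le_trans ab (ltW br)).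
by move=> <-; rewrite addrC subrK.
Qed.

Lemma time_integral0 a w : time_integral a a w = 0.
Proof. by rewrite /time_integral set_itv1 Rintegral_set1. Qed.

(** By Fubini's theorem the mean error is at most the time integral of the mean
    increments over [s, s + h]. *)
Lemma time_integral_modulus e : 0 < e -> exists2 d, 0 < d &
  forall s h, 0 <= s -> 0 <= h -> h < d ->
    \int[Pmu]_w `|time_integral s (s + h) w - h * W (X s w)| <= h * e.
Proof.
move=> e0; have [d d0 Hd] := increment_modulus e0; exists d => // s h s0 h0 hd.
have ssh : s <= s + h by rewrite lerDl.
have bXs := bmeas_comp (mX s0) bW.
pose f (p : measurableTypeR R * Omega) := `|path_fun X W p - W (X s p.2)|.
have bf : bmeas f.
  by apply/bmeas_norm/bmeasB => //; exact: (bmeas_comp measurable_snd bXs).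
have f0 p : 0 <= f p by exact: normr_ge0.
have mI' := mI s (s + h); have Iy' := Iy s (s + h).
have ion g := @bmeas_integrable_on R _ _ leb _ mI' Iy' g.
apply: (@le_trans _ _ (\int[Pmu]_w \int[leb]_(r in `[s, s + h]) f (r, w))).
  apply: (expect_le Pmu1).
  - exact/bmeas_norm/(bmeasB (bmeas_time _ _) (bmeasZ h bXs)).
  - exact: bmeas_time_integral.
  move=> w; rewrite /time_integral.
  have -> : h * W (X s w) = \int[leb]_(r in `[s, s + h]) W (X s w).
    by rewrite Rintegral_cst// mulrC; congr (_ * _); rewrite fine_leb// addrC addKr.
  rewrite -RintegralB//; [|exact: ion (bmeas_pair2 bY w)|exact: ion (bmeas_cst _ _)].
  apply: le_normr_Rintegral => //.
  by apply: ion; exact: bmeasB (bmeas_pair2 bY w) (bmeas_cst _ _).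
rewrite (fubini_time Pmu mI' Iy' bf f0).
have -> : h * e = \int[leb]_(r in `[s, s + h]) e.
  by rewrite Rintegral_cst// mulrC; congr (_ * _); rewrite fine_leb// addrC addKr.
apply: le_Rintegral => //.
- by apply: ion; exact: bmeas_space_integral.
- exact: ion (bmeas_cst _ _).
move=> r /=; rewrite in_itv/= => /andP[sr rh].
rewrite /f /path_fun/= ger0_norm ?(le_trans s0)//.
have -> : r = s + (r - s) by rewrite addrC subrK.
apply: Hd => //; first by rewrite subr_ge0.
by rewrite (le_lt_trans _ hd)// lerBlDl.
Qed.

Definition riemann (t : R) (n : nat) (s : R) (w : Omega) : R :=
  \sum_(0 <= k < n) (t / n%:R) * W (X (s + k%:R * (t / n%:R)) w).

Lemma bmeas_riemann t n s : 0 <= t -> 0 <= s -> bmeas (riemann t n s).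
Proof.
move=> t0 s0; rewrite /riemann; apply: bmeas_sum => k; apply: bmeasZ.
by apply: (bmeas_comp _ bW); apply: mX; rewrite addr_ge0// mulr_ge0// divr_ge0.
Qed.

Lemma riemann_le t n s w : 0 <= t -> 0 <= riemann t n s w <= K * t.
Proof.
move=> t0; have tn0 : 0 <= t / n%:R by rewrite divr_ge0.
apply/andP; split; first by apply: sumr_ge0 => k _; rewrite mulr_ge0.
case: n tn0 => [|n] tn0; first by rewrite /riemann big_geq// mulr_ge0.
apply: (@le_trans _ _ (\sum_(0 <= k < n.+1) (t / n.+1%:R) * K)).
  by apply: ler_sum => k _; rewrite ler_wpM2l.
rewrite sumr_const_nat subn0 -[leLHS]mulr_natl mulrA [_%:R * _]mulrC divfK ?pnatr_eq0//.
by rewrite mulrC.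
Qed.

Lemma riemann_cvg t e : 0 <= t -> 0 < e -> exists N : nat,
  forall s, 0 <= s ->
    \int[Pmu]_w `|time_integral s (s + t) w - riemann t N.+1 s w| <= t * e.
Proof.
move=> t0 e0; have [d d0 Hd] := time_integral_modulus e0.
have [N tN] : exists N : nat, t / N.+1%:R < d.
  have := archi_boundP (divr_ge0 t0 (ltW d0)); set N := Num.bound _ => tN.
  exists N; rewrite ltr_pdivrMr ?ltr0n// mulrC -ltr_pdivrMr//.
  by rewrite (lt_trans tN)// ltr_nat.
exists N => s s0; pose h := t / N.+1%:R.
have h0 : 0 <= h by rewrite divr_ge0.
have -> : t * e = (N.+1%:R * h) * e by rewrite /h mulrC [_ * (t / _)]mulrC divfK ?pnatr_eq0// mulrC.
have {1}-> : t = N.+1%:R * h by rewrite /h mulrC divfK ?pnatr_eq0.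
rewrite /riemann -/h; elim: N.+1 => [|n IH].
  rewrite !mul0r addr0; under eq_Rintegral do rewrite time_integral0 big_geq// subrr normr0.
  by rewrite expect_cst.
have nh0 : 0 <= n%:R * h by rewrite mulr_ge0.
have snh0 : 0 <= s + n%:R * h by rewrite addr_ge0.
have bS : bmeas (fun w => \sum_(0 <= k < n) h * W (X (s + k%:R * h) w)).
  apply: bmeas_sum => k; apply: bmeasZ.
  by apply: (bmeas_comp _ bW); apply: mX; rewrite addr_ge0// mulr_ge0.
have b1 := bmeasB (bmeas_time s (s + n%:R * h)) bS.
have b2 := bmeasB (bmeas_time (s + n%:R * h) (s + n%:R * h + h)) (bmeasZ h
  (bmeas_comp (mX snh0) bW)).
apply: (@le_trans _ _ (\int[Pmu]_w (`|time_integral s (s + n%:R * h) w -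
    \sum_(0 <= k < n) h * W (X (s + k%:R * h) w)| +
   `|time_integral (s + n%:R * h) (s + n%:R * h + h) w - h * W (X (s + n%:R * h) w)|))).
  have -> : n.+1%:R * h = n%:R * h + h by rewrite -natr1 mulrDl mul1r.
  have bS' : bmeas (fun w => \sum_(0 <= k < n.+1) h * W (X (s + k%:R * h) w)).
    apply: bmeas_sum => k; apply: bmeasZ.
    by apply: (bmeas_comp _ bW); apply: mX; rewrite addr_ge0// mulr_ge0.
  apply: (expect_le Pmu1).
  - exact/bmeas_norm/(bmeasB (bmeas_time _ _) bS').
  - exact: bmeasD (bmeas_norm b1) (bmeas_norm b2).
  move=> w; rewrite big_nat_recr//= addrA.
  rewrite (@time_integral_cat s (s + n%:R * h)) ?lerDl//.
  by rewrite opprD addrACA ler_normD.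
rewrite (expectD Pmu1 (bmeas_norm b1) (bmeas_norm b2)) -natr1 !mulrDl mul1r.
by rewrite lerD//; exact: Hd.
Qed.

Notation A := time_integral.

Let A_le s h w : 0 <= h -> A s (s + h) w <= K * h.
Proof.
move=> h0; have ssh : s <= s + h by rewrite lerDl.
by have := time_integral_le w ssh; rewrite [s + h]addrC addrK.
Qed.

Let A0_le t w : 0 <= t -> A 0 t w <= K * t.
Proof. by move=> t0; have := A_le 0 w t0; rewrite add0r. Qed.

Let A_ge0 := time_integral_ge0.

Let bA := bmeas_time.

Let beA a b := bmeas_expR (bA a b).

(** Singletons are closed, so that X_0 = x is an event. *)
Lemma polish_measurable_set1 (x : borel E) : measurable [set x].
Proof.
have [_ [d [[d0 deq] dC dtri dnbhs _]]] := polishE.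
rewrite -[X in measurable X]setCK; apply: measurableC.
apply: sub_sigma_algebra; rewrite openE => y /= yx.
apply/(dnbhs y); exists (d y x).
  rewrite lt_neqAle d0 andbT eq_sym; apply/eqP => /deq yx'.
  exact: yx.
by move=> z /= dyz zx; move: dyz; rewrite zx ltxx.
Qed.

Lemma start_ae (x : borel E) : {ae P x, forall w, X 0 w = x}.
Proof.
exists (~` (X 0 @^-1` [set x])).
have m0 : measurable (X 0 @^-1` [set x]).
  by rewrite -[Y in measurable Y]setTI; apply: mX => //; exact: polish_measurable_set1.
split; first exact: measurableC.
  have := P1 x; rewrite -(setUv (X 0 @^-1` [set x])) measureU//; last 2 first.
  - exact: measurableC.
  - by rewrite setICr.
  rewrite [X in (X + _)%E = _](_ : _ = 1%E); last exact: (markov_start markovX).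
  have e1 (z : \bar R) : (1 + z = 1 -> z = 0)%E.
    by case: z => [r [h]||]//; congr EFin; apply: (addrI 1); rewrite h addr0.
  exact: e1.
by move=> w /= h.
Qed.

Lemma start_expect (x : borel E) (phi : borel E -> R) (Z : Omega -> R) :
  bmeas phi -> bmeas Z ->
  \int[P x]_w (phi (X 0 w) * Z w) = phi x * \int[P x]_w Z w.
Proof.
move=> bphi bZ; have b0 := bmeas_comp (mX (lexx 0)) bphi.
rewrite -(expectZ (P1 x) _ bZ); apply: EFin_inj.
rewrite (expect_EFin (P1 x) (bmeasM b0 bZ)) (expect_EFin (P1 x) (bmeasZ _ bZ)).
apply: ae_eq_integral => //.
- by apply/measurable_EFinP; case: (bmeasM b0 bZ).
- by apply/measurable_EFinP; case: (bmeasZ (phi x) bZ).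
by apply: filterS (start_ae x) => w h _; rewrite h.
Qed.

(** The operator f P_d applied n times to 1: the expectation of the product of
    f along a grid of n points with mesh d, as a function of the first point. *)
Fixpoint grid_fun (f : borel E -> R) (d : R) (n : nat) (y : borel E) : R :=
  if n is n'.+1 then f y * \int[P y]_w grid_fun f d n' (X d w) else 1.

Section grid.
Variables (f : borel E -> R) (d : R).
Hypotheses (bf : bmeas f) (f0 : forall y, 0 <= f y) (d0 : 0 <= d).

Lemma bmeas_grid_fun n : bmeas (grid_fun f d n).
Proof.
elim: n => [|n IH] /=; first exact: bmeas_cst.
exact: bmeasM bf (bmeas_kernel P (bmeas_comp (mX d0) IH)).
Qed.

Lemma grid_fun_ge0 n y : 0 <= grid_fun f d n y.
Proof.
elim: n y => [|n IH] y /=; first exact: ler01.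
by rewrite mulr_ge0// expect_ge0.
Qed.

(** The first factor belongs to the past of s, hence to the past of s + d, where
    the induction hypothesis applies to the remaining factors; the Markov
    property at time s then removes the last step of length d. *)
Lemma grid_expect n x s (Z : Omega -> R) : 0 <= s ->
  @bmeas R _ (g_sigma_algebraType (past_gen X s)) Z -> (forall w, 0 <= Z w) ->
  \int[P x]_w (Z w * \prod_(0 <= k < n) f (X (s + k%:R * d) w)) =
  \int[P x]_w (Z w * grid_fun f d n (X s w)).
Proof.
elim: n s Z => [|n IH] s Z s0 bZ Z0.
  by apply: expect_eq => w; rewrite big_geq.
pose Z' w := Z w * f (X s w).
have ssd : s <= s + d by rewrite lerDl.
have bfX : @bmeas R _ (g_sigma_algebraType (past_gen X s)) (fun w => f (X s w)).
  exact: (bmeas_comp (@measurable_past_X _ _ _ _ X s s s0 (lexx s)) bf).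
have bZ' : @bmeas R _ (g_sigma_algebraType (past_gen X s)) Z' by exact: bmeasM.
have bZ'' : @bmeas R _ (g_sigma_algebraType (past_gen X (s + d))) Z'.
  split; first exact: past_mono ssd bZ'.1.
  by have [M HM] := bZ'.2; exists M.
have Z'0 w : 0 <= Z' w by rewrite mulr_ge0.
transitivity (\int[P x]_w (Z' w * \prod_(0 <= k < n) f (X (s + d + k%:R * d) w))).
  apply: expect_eq => w; rewrite big_nat_recl// mul0r addr0 mulrA; congr (_ * _).
  by apply: eq_bigr => k _; rewrite -natr1 mulrDl mul1r [k%:R * d + d]addrC addrA.
rewrite IH ?addr_ge0// (markov_past markovX _ s0 d0 bZ' Z'0 (bmeas_grid_fun n) (grid_fun_ge0 n)).
by apply: expect_eq => w; rewrite /Z' mulrA.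
Qed.

Lemma grid_shift n x s : 0 <= s ->
  \int[P x]_w \prod_(0 <= k < n) f (X (s + k%:R * d) w) =
  \int[P x]_w grid_fun f d n (X s w).
Proof.
move=> s0; have := @grid_expect n x s (fun=> 1) s0 (bmeas_cst _ 1) (fun=> ler01).
by under eq_Rintegral do rewrite mul1r; under [RHS]eq_Rintegral do rewrite mul1r.
Qed.

Lemma grid_start n x :
  \int[P x]_w \prod_(0 <= k < n) f (X (0 + k%:R * d) w) = grid_fun f d n x.
Proof.
rewrite grid_shift//.
have := start_expect x (bmeas_grid_fun n) (bmeas_cst Omega 1).
rewrite (expect_cst (P1 x)) mulr1 => <-.
by apply: expect_eq => w; rewrite mulr1.
Qed.

End grid.

Definition feynman_kac (t : R) (x : borel E) : R := \int[P x]_w expR (A 0 t w).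

Lemma bmeas_feynman_kac t : bmeas (feynman_kac t).
Proof. by apply: bmeas_kernel; exact: bmeas_expR. Qed.

Lemma expR_riemann_cvg t e : 0 <= t -> 0 < e -> exists N : nat,
  forall s, 0 <= s ->
  \int[Pmu]_w `|expR (A s (s + t) w) - expR (riemann t N.+1 s w)| <= e.
Proof.
move=> t0 e0; pose c := expR (K * t) * (t + 1).
have c0 : 0 < c by rewrite mulr_gt0 ?expR_gt0// ltr_wpDl.
have [N HN] := riemann_cvg t0 (divr_gt0 e0 c0).
exists N => s s0.
have bd := bmeasB (bA s (s + t)) (bmeas_riemann N.+1 t0 s0).
have bd' := bmeasB (bmeas_expR (bA s (s + t)))
  (bmeas_expR (bmeas_riemann N.+1 t0 s0)).
apply: (@le_trans _ _ (\int[Pmu]_w (expR (K * t) * `|A s (s + t) w - riemann t N.+1 s w|))).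
  apply: (expect_le Pmu1 (bmeas_norm bd') (bmeasZ _ (bmeas_norm bd))) => w.
  apply: expR_lipschitz; last by case/andP: (riemann_le N.+1 s w t0).
  have sst : s <= s + t by rewrite lerDl.
  by have := time_integral_le w sst; rewrite [s + t]addrC addrK.
rewrite (expectZ Pmu1 _ (bmeas_norm bd)).
apply: (@le_trans _ _ (expR (K * t) * (t * (e / c)))).
  by rewrite ler_wpM2l ?expR_ge0//; exact: HN.
have -> : expR (K * t) * (t * (e / c)) = e * ((expR (K * t) * t) / c) by ring.
rewrite -[leRHS]mulr1; apply: ler_wpM2l; first exact: ltW.
rewrite ler_pdivrMr// mul1r.
by rewrite /c ler_wpM2l ?expR_ge0// lerDl.
Qed.

(** The Markov property for a functional of a whole stretch of the path.  It
    is exact for exponentials of Riemann sums, which are products along a grid,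
    and both sides are limits of these in mean, because P_h preserves mu. *)
Lemma feynman_kac_shift t h : 0 <= t -> 0 <= h ->
  {ae mu, forall x, \int[P x]_w feynman_kac t (X h w) =
    \int[P x]_w expR (A h (h + t) w)}.
Proof.
move=> t0 h0.
pose D x := \int[P x]_w feynman_kac t (X h w) - \int[P x]_w expR (A h (h + t) w).
have bu := bmeas_feynman_kac t.
have buh := bmeas_comp (mX h0) bu.
have bD : bmeas D by apply: bmeasB; exact: bmeas_kernel.
have small e : 0 < e -> \int[mu]_x `|D x| <= e + e.
  move=> e0; have [N HN] := expR_riemann_cvg t0 e0.
  pose d := t / N.+1%:R; have d0 : 0 <= d by rewrite divr_ge0.
  pose f y := expR (d * W y).
  have bf : bmeas f by exact/bmeas_expR/bmeasZ.
  have f0 y : 0 <= f y by exact: expR_ge0.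
  pose psi := grid_fun f d N.+1.
  have bpsi : bmeas psi by exact: bmeas_grid_fun.
  have Erie s w : expR (riemann t N.+1 s w) = \prod_(0 <= k < N.+1) f (X (s + k%:R * d) w).
    by rewrite /riemann expR_sum.
  have brie s : 0 <= s -> bmeas (fun w => expR (riemann t N.+1 s w)).
    by move=> s0; exact/bmeas_expR/(bmeas_riemann).
  have psi_h x : \int[P x]_w psi (X h w) = \int[P x]_w expR (riemann t N.+1 h w).
    rewrite -(grid_shift bf f0 d0 N.+1 x h0).
    by apply: expect_eq => w; rewrite Erie.
  have psi_0 x : psi x = \int[P x]_w expR (riemann t N.+1 0 w).
    rewrite /psi -(grid_start bf f0 d0 N.+1 x).
    by apply: expect_eq => w; rewrite Erie.
  have bpsih := bmeas_comp (mX h0) bpsi.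
  pose d1 w := `|feynman_kac t (X h w) - psi (X h w)|.
  pose d2 w := `|expR (A h (h + t) w) - expR (riemann t N.+1 h w)|.
  have bd1 : bmeas d1 by exact/bmeas_norm/bmeasB.
  have bd2 : bmeas d2 by exact/bmeas_norm/(bmeasB (beA _ _) (brie _ h0)).
  apply: (@le_trans _ _ (\int[mu]_x (\int[P x]_w d1 w + \int[P x]_w d2 w))).
    apply: (expect_le mu1 (bmeas_norm bD)).
      by apply: bmeasD; exact: bmeas_kernel.
    move=> x; have -> : D x = (\int[P x]_w (feynman_kac t (X h w) - psi (X h w))) -
        (\int[P x]_w (expR (A h (h + t) w) - expR (riemann t N.+1 h w))).
      rewrite (expectB (P1 x) buh bpsih) (expectB (P1 x) (beA _ _) (brie _ h0)) psi_h /D.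
      by ring.
    rewrite (le_trans (ler_normB _ _))// lerD//; apply: (expect_norm (P1 x)).
      exact: bmeasB.
    exact: (bmeasB (beA _ _) (brie _ h0)).
  rewrite (expectD mu1 (bmeas_kernel P bd1) (bmeas_kernel P bd2)) lerD//; last first.
    by rewrite -(expect_law P mu bd2); exact: HN.
  rewrite -(expect_law P mu bd1).
  have bdu := bmeas_norm (bmeasB bu bpsi).
  rewrite (invariant_expect markovX mu_inv h0 bdu); last by move=> y; exact: normr_ge0.
  have bdd := bmeasB (beA 0 t) (brie 0 (lexx 0)).
  apply: (@le_trans _ _ (\int[mu]_x \int[P x]_w `|expR (A 0 t w) - expR (riemann t N.+1 0 w)|)).
    apply: (expect_le mu1 bdu (bmeas_kernel P (bmeas_norm bdd))) => x.
    rewrite psi_0 /feynman_kac -(expectB (P1 x) (beA _ _) (brie _ (lexx 0))).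
    exact: (expect_norm (P1 x)).
  rewrite -(expect_law P mu (bmeas_norm bdd)).
  by have := HN 0 (lexx 0); rewrite add0r.
have D0 : \int[mu]_x `|D x| = 0.
  apply/eqP; rewrite eq_le expect_ge0 ?andbT//.
  apply/ler_addgt0Pr => e e0; rewrite add0r [leRHS]splitr.
  by apply: small; rewrite divr_gt0.
have mD : measurable_fun setT (EFin \o D) by apply/measurable_EFinP; case: bD.
have := (ae_eq_integral_abs mu measurableT mD).1.
rewrite /= -(expect_EFin mu1 (bmeas_norm bD)) D0 => /(_ erefl).
apply: filterS => x /(_ I) /= [] /eqP.
by rewrite subr_eq0 => /eqP.
Qed.

Notation u := feynman_kac.
Let bu := bmeas_feynman_kac.

(** The value of L on the Feynman-Kac function: moving the window [0, t] of the
    time integral by h adds h W (X_t) to the exponent and removes h W (X_0). *)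
Definition fk_generator (t : R) (x : borel E) : R :=
  \int[P x]_w (expR (A 0 t w) * (W (X t w) - W (X 0 w))).

Notation g := fk_generator.

Let bg_in t : 0 <= t -> bmeas (fun w => expR (A 0 t w) * (W (X t w) - W (X 0 w))).
Proof.
by move=> t0; exact: bmeasM (beA 0 t) (bmeasB (bX t0) (bX (lexx 0))).
Qed.

Lemma bmeas_fk_generator t : 0 <= t -> bmeas (fk_generator t).
Proof. by move=> t0; apply: bmeas_kernel; exact: bg_in. Qed.

Definition fk_remainder (t h : R) (w : Omega) : R :=
  h^-1 * (expR (A h (h + t) w) - expR (A 0 t w)) -
  expR (A 0 t w) * (W (X t w) - W (X 0 w)).

(** The exponents differ by the time integral over [t, t + h] minus the one
    over [0, h]; expand the exponential to second order in this difference. *)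
Lemma fk_remainder_le t h w : 0 <= t -> 0 < h -> K * h <= 2^-1 ->
  `|fk_remainder t h w| <= expR (K * t) * (2 * K ^+ 2 * h +
     h^-1 * `|A t (t + h) w - h * W (X t w)| + h^-1 * `|A 0 (0 + h) w - h * W (X 0 w)|).
Proof.
move=> t0 h0 Kh; have h0' := ltW h0.
have th0 : t <= t + h by rewrite lerDl.
have hht : h <= h + t by rewrite lerDl.
have := time_integral_cat w t0 th0.
rewrite [in X in X = _](addrC t h) (time_integral_cat w h0' hht) /fk_remainder.
rewrite -[X in A 0 X w + _ = _](add0r h) -(add0r t) => cat.
have a1 := A_le t w h0'; have a2 := A_le 0 w h0'.
have a3 := A_ge0 t (t + h) w; have a4 := A_ge0 0 (0 + h) w.
have a5 := A0_le w t0; rewrite !add0r in cat a1 a2 a3 a4 a5 *.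
move: (A 0 h w) (A t (t + h) w) (A 0 t w) (A h (h + t) w) cat a1 a2 a3 a4 a5 => al
  be a ga cat a1 a2 a3 a4 a5.
have -> : ga = a + (be - al) by move: cat; lra.
set x := be - al.
have xh : `|x| <= K * h by rewrite ler_norml; apply/andP; split; rewrite /x; lra.
have x2 : x <= 2^-1 by apply: le_trans Kh; apply: le_trans xh; exact: ler_norm.
have Ex := expR_quad x2.
rewrite expRD; set wt := W (X t w); set w0 := W (X 0 w).
have -> : h^-1 * (expR a * expR x - expR a) - expR a * (wt - w0) =
  expR a * (h^-1 * (expR x - 1 - x) + h^-1 * (be - h * wt) - h^-1 * (al - h * w0)).
  by rewrite /x; field; rewrite lt0r_neq0.
rewrite normrM (ger0_norm (expR_ge0 a)) ler_pM ?expR_ge0 ?ler_expR//.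
have hi : 0 < h^-1 by rewrite invr_gt0.
rewrite (le_trans (ler_normB _ _))// lerD//; last by rewrite normrM gtr0_norm.
rewrite (le_trans (ler_normD _ _))// lerD//; last by rewrite normrM gtr0_norm.
rewrite normrM gtr0_norm// ler_pdivrMl//; apply: (le_trans Ex).
have -> : h * (2 * K ^+ 2 * h) = 2 * (K * h) ^+ 2 by ring.
by rewrite ler_wpM2l// -real_normK ?num_real// lerXn2r// nnegrE mulr_ge0.
Qed.

Lemma bmeas_fk_remainder t h : 0 <= t -> bmeas (fk_remainder t h).
Proof.
move=> t0; exact: bmeasB (bmeasZ h^-1 (bmeasB (beA h (h + t)) (beA 0 t))) (bg_in t0).
Qed.

Lemma fk_remainder_cvg t e : 0 <= t -> 0 < e -> exists2 d, 0 < d &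
  forall h, 0 < h -> h < d -> K * h <= 2^-1 /\ \int[Pmu]_w `|fk_remainder t h w| <= e.
Proof.
move=> t0 e0; pose c := expR (K * t).
have c0 : 0 < c by exact: expR_gt0.
have e3 : 0 < e / (3 * c) by rewrite divr_gt0// mulr_gt0.
have [d d0 Hd] := time_integral_modulus e3.
pose d1 := (2 * (K + 1))^-1; pose d2 := e / (3 * c * (2 * K ^+ 2 + 1)).
have d10 : 0 < d1 by rewrite invr_gt0 mulr_gt0// ltr_wpDl.
have k2 : 0 < 2 * K ^+ 2 + 1 by rewrite ltr_wpDl// mulr_ge0// sqr_ge0.
have d20 : 0 < d2 by rewrite divr_gt0// mulr_gt0// mulr_gt0.
exists (Num.min d (Num.min d1 d2)); first by rewrite !lt_min d0 d10 d20.
move=> h h0; rewrite !lt_min => /andP[hd /andP[h1 h2]].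
have h0' := ltW h0; have hi0 : 0 < h^-1 by rewrite invr_gt0.
have Kh : K * h <= 2^-1.
  apply: (@le_trans _ _ ((K + 1) * d1)); first by apply: ler_pM => //; [lra|exact: ltW].
  by rewrite /d1 invfM mulrCA divff ?mulr1// gt_eqF// ltr_wpDl.
split => //.
have bt := bmeas_norm (bmeasB (bA t (t + h)) (bmeasZ h (bX t0))).
have b0 := bmeas_norm (bmeasB (bA 0 (0 + h)) (bmeasZ h (bX (lexx 0)))).
have bc := bmeas_cst Omega (2 * K ^+ 2 * h).
have b01 := bmeasD bc (bmeasZ h^-1 bt); have b02 := bmeasZ h^-1 b0.
apply: (@le_trans _ _ (\int[Pmu]_w (c * (2 * K ^+ 2 * h +
     h^-1 * `|A t (t + h) w - h * W (X t w)| + h^-1 * `|A 0 (0 + h) w - h * W (X 0 w)|)))).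
  apply: (expect_le Pmu1 (bmeas_norm (bmeas_fk_remainder h t0)) (bmeasZ c (bmeasD b01 b02))).
  by move=> w; exact: fk_remainder_le.
rewrite (expectZ Pmu1 c (bmeasD b01 b02)) (expectD Pmu1 b01 b02).
rewrite (expectD Pmu1 bc (bmeasZ h^-1 bt)) (expectZ Pmu1 _ bt) (expectZ Pmu1 _ b0)
  (expect_cst Pmu1).
have H1 := Hd t h t0 h0' hd; have H2 := Hd 0 h (lexx 0) h0' hd.
have e1 : 2 * K ^+ 2 * h <= e / (3 * c).
  apply: (@le_trans _ _ ((2 * K ^+ 2 + 1) * d2)).
    by apply: ler_pM => //; [by rewrite mulr_ge0// sqr_ge0|lra|exact: ltW].
  by rewrite /d2 le_eqVlt; apply/orP; left; apply/eqP; field; rewrite (gt_eqF c0) (gt_eqF k2).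
rewrite -ler_pdivrMl// in H1; rewrite -ler_pdivrMl// in H2.
apply: (@le_trans _ _ (c * (e / (3 * c) + e / (3 * c) + e / (3 * c)))).
  by rewrite ler_pM2l// lerD// lerD.
by rewrite le_eqVlt; apply/orP; left; apply/eqP; field; rewrite (gt_eqF c0).
Qed.

Let bg t (t0 : 0 <= t) := bmeas_fk_generator t0.

Let A_dist s h w : 0 <= s -> 0 <= h -> `|A s (s + h) w - h * W (X s w)| <= K * h.
Proof.
move=> s0 h0; have a1 := A_le s w h0.
have a2 : 0 <= A s (s + h) w by exact: time_integral_ge0.
have a3 : h * W (X s w) <= K * h by rewrite mulrC ler_wpM2r.
have a4 : 0 <= h * W (X s w) by rewrite mulr_ge0.
by rewrite ler_norml; apply/andP; split; lra.
Qed.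

(** By [feynman_kac_shift] the error of the difference quotient is the expectation
    of [fk_remainder]; it is bounded, so its convergence in mean gives
    convergence in mean square. *)
Lemma generator_feynman_kac t : 0 <= t -> generator X P mu (u t) (g t).
Proof.
move=> t0; split; [exact: (bmeas_Lfun2 mu1)|exact: (bmeas_Lfun2 mu1 (bg t0))|].
pose Z h := fk_remainder t h.
have bZ h : bmeas (Z h) := bmeas_fk_remainder h t0.
pose D h x := h^-1 * (semigroup X P h (u t) x - u t x) - g t x.
have bS h : 0 <= h -> bmeas (semigroup X P h (u t)).
  by move=> h0; apply: bmeas_kernel; exact: bmeas_comp (mX h0) (bu t).
have bD h : 0 <= h -> bmeas (D h).
  by move=> h0; exact: bmeasB (bmeasZ h^-1 (bmeasB (bS h h0) (bu t))) (bg t0).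
pose C := expR (K * t) * (3 * K).
have C0 : 0 <= C by rewrite mulr_ge0 ?expR_ge0// mulr_ge0.
(* C bounds the remainder, so the mean square is at most C times the mean. *)
have ID h : 0 < h -> K * h <= 2^-1 ->
    \int[mu]_x (D h x ^+ 2) <= C * \int[Pmu]_w `|Z h w|.
  move=> h0 Kh; have h0' := ltW h0.
  pose EZ x := \int[P x]_w Z h w.
  have bEZ : bmeas EZ by exact: bmeas_kernel.
  have EZC x : `|EZ x| <= C.
    apply: (expect_norm_le (P1 x) (bZ h)) => w.
    apply: (le_trans (fk_remainder_le w t0 h0 Kh)).
    rewrite /C ler_pM2l ?expR_gt0//.
    have -> : 3 * K = K + K + K by ring.
    rewrite lerD//; last by rewrite ler_pdivrMl// [leRHS]mulrC A_dist.
    rewrite lerD//; last by rewrite ler_pdivrMl// [leRHS]mulrC A_dist.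
    have -> : 2 * K ^+ 2 * h = K * (2 * (K * h)) by ring.
    by rewrite -[leRHS]mulr1 ler_wpM2l//; lra.
  have -> : \int[mu]_x (D h x ^+ 2) = \int[mu]_x (EZ x ^+ 2).
    apply: EFin_inj; rewrite (expect_EFin mu1 (bmeasX 2 (bD h h0'))).
    rewrite (expect_EFin mu1 (bmeasX 2 bEZ)); apply: ae_eq_integral => //.
    - by apply/measurable_EFinP; case: (bmeasX 2 (bD h h0')).
    - by apply/measurable_EFinP; case: (bmeasX 2 bEZ).
    apply: filterS (feynman_kac_shift t0 h0') => x sx _.
    congr (_ ^+ 2)%:E; rewrite /D /semigroup sx /EZ /Z /fk_remainder.
    rewrite (expectB (P1 x) (bmeasZ h^-1 (bmeasB (beA h (h + t)) (beA 0 t)))); last first.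
      exact: bmeasM (beA 0 t) (bmeasB (bX t0) (bX (lexx 0))).
    by rewrite (expectZ (P1 x) _ (bmeasB (beA h (h + t)) (beA 0 t))) (expectB (P1 x)
      (beA _ _) (beA _ _)).
  have bEn := bmeas_norm bEZ.
  apply: (@le_trans _ _ (\int[mu]_x (C * `|EZ x|))).
    apply: (expect_le mu1 (bmeasX 2 bEZ) (bmeasZ C bEn)) => x.
    by rewrite -real_normK ?num_real// expr2 ler_wpM2r.
  rewrite (expectZ mu1 _ bEn) ler_wpM2l// (expect_law P mu (bmeas_norm (bZ h))).
  apply: (expect_le mu1 bEn (bmeas_kernel P (bmeas_norm (bZ h)))) => x.
  exact: (expect_norm (P1 x) (bZ h)).
have LE : {near 0^'+, (fun h => (Num.sqrt (\int[mu]_x (D h x ^+ 2)))%:E) =1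
    (fun h => Lnorm mu 2%:E (EFin \o D h))}.
  by near=> h; rewrite (Lnorm2_bmeas mu1)//; apply: bD.
apply: cvg_trans (near_eq_cvg LE) _.
apply: cvg_EFin; first by near=> h.
apply/cvgr0Pnorm_le => e e0.
have ec : 0 < e ^+ 2 / (C + 1) by rewrite divr_gt0 ?exprn_gt0// ltr_wpDl.
have [d d0 Hd] := fk_remainder_cvg t0 ec.
near=> h; have h0 : 0 < h by near: h; exact: nbhs_right_gt.
have hd : h < d by near: h; exact: nbhs_right_lt.
have [Kh HZ] := Hd h h0 hd.
rewrite ger0_norm ?sqrtr_ge0// -(ger0_norm (ltW e0)) -sqrtr_sqr.
rewrite ler_sqrt ?sqr_ge0// (le_trans (ID h h0 Kh))//.
apply: (@le_trans _ _ ((C + 1) * (e ^+ 2 / (C + 1)))).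
  by apply: ler_pM => //; [exact: expect_ge0|rewrite lerDl].
by rewrite mulrCA divff ?mulr1// gt_eqF// ltr_wpDl.
Unshelve. all: by end_near. Qed.

Lemma feynman_kac_ge1 t x : 1 <= u t x.
Proof.
rewrite -[leLHS](expect_cst (P1 x)).
by apply: (expect_le (P1 x) (bmeas_cst _ _) (beA 0 t)) => w;
  rewrite (le_trans _ (expR_ge1Dx _))// lerDl.
Qed.

Lemma feynman_kac_le t x : 0 <= t -> u t x <= expR (K * t).
Proof.
move=> t0; rewrite -[leRHS](expect_cst (P1 x)).
by apply: (expect_le (P1 x) (beA 0 t) (bmeas_cst _ _)) => w; rewrite ler_expR A0_le.
Qed.

Lemma feynman_kac0 x : u 0 x = 1.
Proof.
rewrite -(expect_cst (P1 x) 1); apply: expect_eq => w.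
by rewrite time_integral0 expR0.
Qed.

Let rem t h w := expR (A 0 (t + h) w) - expR (A 0 t w) -
  h * (expR (A 0 t w) * W (X t w)).

Let brem t h : 0 <= t -> bmeas (rem t h).
Proof.
by move=> t0; exact: bmeasB (bmeasB (beA _ _) (beA _ _)) (bmeasZ h (bmeasM (beA 0 t) (bX t0))).
Qed.

Let rem_le t h w : 0 <= t -> 0 <= h -> K * h <= 2^-1 ->
  `|rem t h w| <= expR (K * t) * (2 * (K * h) ^+ 2 + `|A t (t + h) w - h * W (X t w)|) /\
  0 <= expR (A 0 (t + h) w) - expR (A 0 t w) <= expR (K * t) * (2 * (K * h)).
Proof.
move=> t0 h0 Kh; have th : t <= t + h by rewrite lerDl.
rewrite /rem (time_integral_cat w t0 th) expRD.
have a1 := A_le t w h0; have a2 := A_ge0 t (t + h) w.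
have a3 := A0_le w t0; rewrite -ler_expR in a3.
have := expR_gt0 (A 0 t w); move: (expR (A 0 t w)) a3 => a a3 a0.
move: (A t (t + h) w) a1 a2 => b a1 a2; set v := W (X t w).
have b2 : b <= 2^-1 by exact: le_trans Kh.
have Eb := expR_quad b2.
have bb : b ^+ 2 <= (K * h) ^+ 2 by rewrite lerXn2r// nnegrE (le_trans a2).
split.
  have -> : a * expR b - a - h * (a * v) = a * ((expR b - 1 - b) + (b - h * v)) by ring.
  rewrite normrM (gtr0_norm a0) ler_pM ?(ltW a0)//.
  rewrite (le_trans (ler_normD _ _))// lerD2r (le_trans Eb)// ler_wpM2l//.
have -> : a * expR b - a = a * (expR b - 1) by ring.
have e1 := expR_ge1Dx b.
rewrite mulr_ge0 ?(ltW a0)//=; last by lra.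
rewrite ler_pM ?(ltW a0)//; first by lra.
have bb' : 2 * b ^+ 2 <= b.
  by rewrite expr2 mulrA -[leRHS]mul1r ler_wpM2r//; lra.
have := ler_norm (expR b - 1 - b); lra.
Qed.

Let k_ t x := \int[P x]_w (expR (A 0 t w) * W (X t w)).

(** The Feynman-Kac equation: the time derivative [k_ t] of u_t is
    L u_t + W u_t. *)
Let kE t x : 0 <= t -> k_ t x = g t x + W x * u t x.
Proof.
move=> t0; rewrite -(start_expect x bW (beA 0 t)).
have b1 := bmeasM (beA 0 t) (bmeasB (bX t0) (bX (lexx 0))).
have b2 := bmeasM (bX (lexx 0)) (beA 0 t).
by rewrite -(expectD (P1 x) b1 b2); apply: expect_eq => w; ring.
Qed.

Variable c : R.
Hypothesis c0 : 0 <= c.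
Hypothesis energy : forall t, 0 <= t ->
  \int[mu]_x (W x * u t x ^+ 2 + g t x * u t x) <= c * \int[mu]_x (u t x ^+ 2).

Let N t := \int[mu]_x (u t x ^+ 2).

(** An integrated form of N' = 2 <u_t, L u_t + W u_t> <= 2 c N.  The error is
    uniform in t <= T because the modulus of the time integrals is. *)
Let N_step T e : 0 < e -> exists2 d, 0 < d & forall t h, 0 <= t -> t <= T ->
  0 <= h -> h < d -> N (t + h) <= N t + h * (2 * c * N t) + h * e.
Proof.
move=> e0; pose M := expR (K * T) * expR (K * T).
have M0 : 0 < M by rewrite mulr_gt0// expR_gt0.
have e4 : 0 < e / (4 * M) by rewrite divr_gt0// mulr_gt0.
have [d d0 Hd] := time_integral_modulus e4.
pose d1 := (2 * (K + 1))^-1; pose d2 := e / (16 * M * (K ^+ 2 + 1)).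
have d10 : 0 < d1 by rewrite invr_gt0 mulr_gt0// ltr_wpDl.
have k2 : 0 < K ^+ 2 + 1 by rewrite ltr_wpDl// sqr_ge0.
have d20 : 0 < d2 by rewrite divr_gt0// mulr_gt0// mulr_gt0.
exists (Num.min d (Num.min d1 d2)); first by rewrite !lt_min d0 d10 d20.
move=> t h t0 tT h0; rewrite !lt_min => /andP[hd /andP[h1 h2]].
have Kh : K * h <= 2^-1.
  apply: (@le_trans _ _ ((K + 1) * d1)); first by apply: ler_pM => //; [lra|exact: ltW].
  by rewrite /d1 invfM mulrCA divff ?mulr1// gt_eqF// ltr_wpDl.
have EtT : expR (K * t) <= expR (K * T) by rewrite ler_expR ler_wpM2l.
pose rho x := \int[P x]_w rem t h w.
have br := brem h t0; have brho : bmeas rho := bmeas_kernel P br.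
have bk : bmeas (k_ t) := bmeas_kernel P (bmeasM (beA 0 t) (bX t0)).
have bD := bmeasB (beA 0 (t + h)) (beA 0 t).
have duE x : u (t + h) x - u t x = \int[P x]_w (expR (A 0 (t + h) w) - expR (A 0 t w)).
  by rewrite (expectB (P1 x) (beA _ _) (beA _ _)).
have du x : u (t + h) x - u t x = h * k_ t x + rho x.
  have bh := bmeasZ h (bmeasM (beA 0 t) (bX t0)).
  rewrite duE /rho /rem (expectB (P1 x) bD bh) (expectZ (P1 x) _ (bmeasM (beA 0 t)
    (bX t0))); rewrite /k_; ring.
have du_le x : (u (t + h) x - u t x) ^+ 2 <= M * (4 * (K * h) ^+ 2).
  have -> : M * (4 * (K * h) ^+ 2) = (expR (K * T) * (2 * (K * h))) ^+ 2 by rewrite /M; ring.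
  have H : 0 <= u (t + h) x - u t x <= expR (K * T) * (2 * (K * h)).
    rewrite duE expect_ge0//=; last by move=> w; have [_ /andP[]] := rem_le w t0 h0 Kh.
    rewrite -[leRHS](expect_cst (P1 x)); apply: (expect_le (P1 x) bD (bmeas_cst _ _)) => w.
    have [_ /andP[_ h']] := rem_le w t0 h0 Kh; apply: (le_trans h').
    by rewrite ler_wpM2r// !mulr_ge0.
  by case/andP: H => H1 H2; rewrite lerXn2r// nnegrE (le_trans H1).
have rho_le : \int[mu]_x `|rho x| <= expR (K * T) * (2 * (K * h) ^+ 2 + h * (e / (4 * M))).
  apply: (@le_trans _ _ (\int[Pmu]_w `|rem t h w|)).
    rewrite (expect_law P mu (bmeas_norm br)).
    apply: (expect_le mu1 (bmeas_norm brho) (bmeas_kernel P (bmeas_norm br))) => x.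
    exact: (expect_norm (P1 x) br).
  have bt := bmeas_norm (bmeasB (bA t (t + h)) (bmeasZ h (bX t0))).
  have bc := bmeas_cst Omega (2 * (K * h) ^+ 2).
  apply: (@le_trans _ _ (\int[Pmu]_w (expR (K * T) * (2 * (K * h) ^+ 2 + `|A t (t +
    h) w - h * W (X t w)|)))).
    apply: (expect_le Pmu1 (bmeas_norm br) (bmeasZ _ (bmeasD bc bt))) => w.
    have [h' _] := rem_le w t0 h0 Kh; apply: (le_trans h').
    by rewrite ler_wpM2r// addr_ge0// mulr_ge0// sqr_ge0.
  rewrite (expectZ Pmu1 _ (bmeasD bc bt)) (expectD Pmu1 bc bt) (expect_cst Pmu1).
  by rewrite ler_wpM2l ?expR_ge0// lerD2l; exact: Hd.
have bn := bmeas_norm brho.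
have b1 := bmeasX 2 (bu t).
have b2 := bmeasM (bu t) bk.
have b12 := bmeasD b1 (bmeasZ (2 * h) b2).
have b3 := bmeasZ (2 * expR (K * T)) bn.
have b123 := bmeasD b12 b3.
have bC := bmeas_cst (borel E) (M * (4 * (K * h) ^+ 2)).
apply: (@le_trans _ _ (\int[mu]_x (u t x ^+ 2 + 2 * h * (u t x * k_ t x) +
   2 * expR (K * T) * `|rho x| + M * (4 * (K * h) ^+ 2)))).
  apply: (expect_le mu1 (bmeasX 2 (bu (t + h))) (bmeasD b123 bC)) => x.
  apply: sqr_increment_le (du x) (du_le x).
    exact: le_trans ler01 (feynman_kac_ge1 _ _).
  exact: le_trans (feynman_kac_le _ t0) EtT.
rewrite (expectD mu1 b123 bC) (expectD mu1 b12 b3) (expectD mu1 b1 (bmeasZ _ b2)).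
rewrite (expectZ mu1 _ b2) (expectZ mu1 _ bn) (expect_cst mu1) -/(N t).
have En := energy t0; rewrite -/(N t) in En.
have IE : \int[mu]_x (u t x * k_ t x) <= c * N t.
  rewrite (_ : \int[mu]_x (u t x * k_ t x) = \int[mu]_x (W x * u t x ^+ 2 + g t x * u t x))//.
  by apply: expect_eq => x; rewrite kE//; ring.
have hK : M * (8 * (K * h) ^+ 2) <= h * (e / 2).
  have -> : M * (8 * (K * h) ^+ 2) = h * (h * (8 * M * K ^+ 2)) by ring.
  rewrite ler_wpM2l//.
  apply: (@le_trans _ _ (d2 * (8 * M * (K ^+ 2 + 1)))).
    apply: ler_pM => //; [|exact: ltW|]; first by rewrite !mulr_ge0 ?sqr_ge0// ltW.
    by rewrite ler_wpM2l ?lerDl// mulr_ge0// ltW.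
  by rewrite le_eqVlt; apply/orP; left; apply/eqP; rewrite /d2; field;
    rewrite (gt_eqF M0) (gt_eqF k2).
have h3 : 2 * expR (K * T) * \int[mu]_x `|rho x| <= M * (4 * (K * h) ^+ 2) + h * (e / 2).
  apply: (@le_trans _ _ (2 * expR (K * T) * (expR (K * T) * (2 * (K * h) ^+ 2 + h *
    (e / (4 * M)))))).
    by rewrite ler_wpM2l// mulr_ge0// expR_ge0.
  have -> : 2 * expR (K * T) * (expR (K * T) * (2 * (K * h) ^+ 2 + h * (e / (4 * M)))) =
     2 * M * (2 * (K * h) ^+ 2 + h * (e / (4 * M))) by rewrite /M; ring.
  by rewrite le_eqVlt; apply/orP; left; apply/eqP; field; rewrite (gt_eqF M0).
have h4 : 2 * h * \int[mu]_x (u t x * k_ t x) <= h * (2 * c * N t).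
  have -> : h * (2 * c * N t) = 2 * h * (c * N t) by ring.
  by rewrite ler_wpM2l// mulr_ge0.
have e2 : h * e = h * (e / 2) + h * (e / 2) by field.
have e8 : M * (8 * (K * h) ^+ 2) = M * (4 * (K * h) ^+ 2) + M * (4 * (K * h) ^+ 2) by ring.
rewrite e2; move: h3 h4 hK; rewrite e8.
set x1 := _ * \int[mu]_x `|rho x|; set x2 := _ * \int[mu]_x (u t x * k_ t x).
move: x1 x2 (M * _) (h * (e / 2)) (h * (2 * c * N t)) (N t) => x1 x2 x3 x4 x5 x6.
lra.
Qed.

Lemma feynman_kac_norm T : 0 <= T -> \int[mu]_x (u T x ^+ 2) <= expR (2 * c * T).
Proof.
move=> T0; apply: (@discrete_gronwall _ N) => //.
- by rewrite mulr_ge0.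
- by move=> t; apply: expect_ge0 => x; exact: sqr_ge0.
- exact: N_step.
rewrite -[leRHS](expect_cst mu1) le_eqVlt; apply/orP; left; apply/eqP.
by apply: expect_eq => x; rewrite feynman_kac0 expr1n.
Qed.

End feynman_kac.

(** * The energy inequality *)

Section energy.
Context (R : realType) (E : ptopologicalType) (dO : measure_display)
  (Omega : measurableType dO) (X : R -> Omega -> borel E)
  (P : R.-pker (borel E) ~> Omega) (mu : probability (borel E) R).
Hypotheses (markovX : markov_process X P).
Let mX u (u0 : 0 <= u) := measurable_X markovX u0.
Let mu1 := @probability_setT _ _ _ mu.
Let P1 y := @prob_kernel _ _ _ _ _ P y.

Lemma generatorZ a f g : bmeas f -> bmeas g -> generator X P mu f g ->
  generator X P mu (fun x => a * f x) (fun x => a * g x).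
Proof.
move=> bf bg [_ _ cvg]; split.
- exact: (bmeas_Lfun2 mu1 (bmeasZ a bf)).
- exact: (bmeas_Lfun2 mu1 (bmeasZ a bg)).
pose D h x := h^-1 * (semigroup X P h f x - f x) - g x.
have LE : {near 0^'+, (fun h => `|a|%:E * Lnorm mu 2%:E (EFin \o D h))%E =1
    (fun h => Lnorm mu 2%:E (fun x => (h^-1 * (semigroup X P h (fun x => a * f x) x -
      a * f x) - a * g x)%:E))}.
  near=> h; have h0 : 0 <= h by apply: ltW; near: h; exact: nbhs_right_gt.
  have bfh := bmeas_comp (mX h0) bf.
  have bD : bmeas (D h).
    exact: bmeasB (bmeasZ h^-1 (bmeasB (bmeas_kernel P bfh) bf)) bg.
  rewrite (_ : (fun x => _%:E) = EFin \o (fun x => a * D h x)); last first.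
    apply/funext => x /=; rewrite /semigroup (expectZ (P1 x) _ bfh) /D /semigroup.
    by congr EFin; ring.
  rewrite (Lnorm2_bmeas mu1 bD) (Lnorm2_bmeas mu1 (bmeasZ a bD)) -EFinM; congr EFin.
  rewrite -sqrtr_sqr -sqrtrM ?sqr_ge0// -(expectZ mu1 _ (bmeasX 2 bD)).
  by congr Num.sqrt; apply: expect_eq => x; rewrite exprMn.
apply: cvg_trans (near_eq_cvg LE) _.
have H : (fun h => `|a|%:E * Lnorm mu 2%:E (EFin \o D h))%E @ 0^'+ -->
    (`|a|%:E * 0)%E by apply: cvgeZl.
by rewrite mule0 in H.
Unshelve. all: by end_near. Qed.

Variables (F : R -> R) (k : R).
Hypotheses (k0 : 0 < k) (F_ln : forall x, 0 < x -> F x = k * ln x).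
Hypothesis mu_sobolev : F_sobolev X P mu F.

Lemma bmeas_ln (f : borel E -> R) a : 0 < a -> (forall x, a <= f x) -> bmeas f ->
  bmeas (fun x => ln (f x)).
Proof.
move=> a0 af [mf [M fM]]; apply: (@bmeas_bounded _ _ _ _ (`|ln a| + `|ln M|)).
  by apply: measurableT_comp mf; exact: measurable_ln.
move=> x; have fx0 : 0 < f x by exact: lt_le_trans (af x).
have fM' : f x <= M by rewrite (le_trans _ (fM x))// ler_norm.
have h1 : ln a <= ln (f x) by rewrite ler_ln ?posrE.
have h2 : ln (f x) <= ln M by rewrite ler_ln ?posrE// (lt_le_trans fx0).
have := ler_norm (ln M); have := ler_norm (- ln a); rewrite normrN.
have := normr_ge0 (ln M); have := normr_ge0 (ln a).
by rewrite ler_norml => *; apply/andP; split; lra.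
Qed.

Section variational.
Variables (W : borel E -> R) (bW : bmeas W).
Let Z := \int[mu]_x expR (W x / k).

Lemma partition_gt0 : 0 < Z.
Proof.
have [K WK] := bW.2; have bWk := bmeas_expR (bmeasM bW (bmeas_cst _ k^-1)).
apply: (@lt_le_trans _ _ (expR (- K / k))); first exact: expR_gt0.
rewrite -[leLHS](expect_cst mu1); apply: (expect_le mu1 (bmeas_cst _ _) bWk) => x.
rewrite ler_expR ler_pM2r ?invr_gt0//.
by have := WK x; rewrite ler_norml => /andP[].
Qed.

(** Let y be the square of the normalized f.  The Sobolev inequality bounds the
    entropy k int y ln y by the energy, and Gibbs' variational principle bounds
    int W y - k int y ln y by k ln Z; the latter integrates 1 + r <= exp r at
    r = W / k - ln y - ln Z against y.  The lower bound on f keeps ln y bounded. *)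
Lemma sobolev_energy f g b : bmeas f -> bmeas g -> 0 < b -> (forall x, b <= f x) ->
  generator X P mu f g ->
  \int[mu]_x (W x * f x ^+ 2 + g x * f x) <= k * ln Z * \int[mu]_x (f x ^+ 2).
Proof.
move=> bf bg b0 fb Lfg; pose N := \int[mu]_x (f x ^+ 2).
have Z0 := partition_gt0.
have N0 : 0 < N.
  apply: (@lt_le_trans _ _ (b ^+ 2)); first by rewrite exprn_gt0.
  rewrite -[leLHS](expect_cst mu1).
  apply: (expect_le mu1 (bmeas_cst _ _) (bmeasX 2 bf)) => x.
  by rewrite lerXn2r// nnegrE ltW// (lt_le_trans b0).
pose a := (Num.sqrt N)^-1.
have a0 : 0 < a by rewrite invr_gt0 sqrtr_gt0.
have a2 : a ^+ 2 = N^-1 by rewrite exprVn sqr_sqrtr// ltW.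
pose y x := (a * f x) ^+ 2.
have bfa := bmeasZ a bf; have by_ : bmeas y := bmeasX 2 bfa.
have ymin x : (a * b) ^+ 2 <= y x.
  by rewrite lerXn2r ?nnegrE ?mulr_ge0 ?(ltW a0) ?(ltW b0) ?(ltW (lt_le_trans b0 (fb
    x)))// ler_pM2l.
have ab0 : 0 < (a * b) ^+ 2 by rewrite exprn_gt0// mulr_gt0.
have y0 x : 0 < y x by exact: lt_le_trans (ymin x).
have bln := bmeas_ln ab0 ymin by_.
have Ny : \int[mu]_x y x = 1.
  transitivity (\int[mu]_x (a ^+ 2 * f x ^+ 2)); first by apply: expect_eq => x; rewrite /y exprMn.
  by rewrite (expectZ mu1 _ (bmeasX 2 bf)) a2 mulVf// gt_eqF.
have bgf := bmeasM bg bf.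
have bylny := bmeasM by_ bln.
have sob : k * \int[mu]_x (y x * ln (y x)) <= - (a ^+ 2 * \int[mu]_x (g x * f x)).
  have h1 : (\int[mu]_x (((a * f x) ^+ 2)%:E) = 1)%E.
    by have := expect_EFin mu1 by_; rewrite Ny /y => <-.
  have := mu_sobolev (generatorZ a bf bg Lfg) h1.
  have -> : (\int[mu]_x ((a * f x) ^+ 2 * F ((a * f x) ^+ 2))%:E)%E =
      (\int[mu]_x (k * (y x * ln (y x))))%:E.
    rewrite (expect_EFin mu1 (bmeasZ k bylny)); apply: eq_integral => x _.
    by rewrite F_ln ?y0// -/(y x); congr EFin; ring.
  rewrite lee_fin (expectZ mu1 _ bylny) -(expectZ mu1 _ bgf).
  by rewrite (_ : \int[mu]_x (a * g x * (a * f x)) = \int[mu]_x (a ^+ 2 * (g x * f x)))//;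
    apply: expect_eq => x; ring.
have bWy := bmeasM bW by_.
have bG := bmeas_expR (bmeasM bW (bmeas_cst _ k^-1)).
have gibbs : \int[mu]_x (W x * y x) - k * \int[mu]_x (y x * ln (y x)) - k * ln Z <= 0.
  have -> : k * ln Z = \int[mu]_x (k * ln Z * y x) by rewrite (expectZ mu1 _ by_) Ny mulr1.
  rewrite -(expectZ mu1 _ bylny).
  rewrite -(expectB mu1 bWy (bmeasZ k bylny)).
  rewrite -(expectB mu1 (bmeasB bWy (bmeasZ k bylny)) (bmeasZ (k * ln Z) by_)).
  have -> : (0 : R) = \int[mu]_x (k * (Z^-1 * expR (W x / k) - y x)).
    rewrite (expectZ mu1 _ (bmeasB (bmeasZ Z^-1 bG) by_)) (expectB mu1 (bmeasZ Z^-1 bG) by_).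
    by rewrite (expectZ mu1 _ bG) Ny -/Z mulVf ?subrr ?mulr0// gt_eqF.
  apply: (expect_le mu1).
  - exact: bmeasB (bmeasB bWy (bmeasZ k bylny)) (bmeasZ (k * ln Z) by_).
  - exact: (@bmeasZ R _ _ k _ (bmeasB (bmeasZ Z^-1 bG) by_)).
  move=> x; have yx := y0 x.
  have := expR_ge1Dx (W x / k - ln (y x) - ln Z).
  rewrite !expRD !expRN !lnK ?posrE// => h.
  have -> : W x * y x - k * (y x * ln (y x)) - k * ln Z * y x =
     k * y x * (W x / k - ln (y x) - ln Z) by field; rewrite gt_eqF.
  have -> : k * (Z^-1 * expR (W x / k) - y x) =
     k * y x * (expR (W x / k) / y x / Z - 1) by field; rewrite !gt_eqF.
  apply: ler_wpM2l; first by rewrite mulr_ge0 ?ltW.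
  by rewrite lerBrDl.
have bWf := bmeasM bW (bmeasX 2 bf).
have EWy : \int[mu]_x (W x * y x) = a ^+ 2 * \int[mu]_x (W x * f x ^+ 2).
  by rewrite -(expectZ mu1 _ bWf); apply: expect_eq => x; rewrite /y; ring.
rewrite (expectD mu1 bWf bgf) -/N -ler_pdivrMr// [_ / N]mulrC -a2 mulrDr -EWy.
by move: sob gibbs; lra.
Qed.

End variational.
End energy.

(** * Exponential moments of the time integral *)

(** Change of measure and the Cauchy-Schwarz inequality. *)
Lemma integral_density_le (R : realType) d (T : measurableType d)
    (mu nu : probability T R) (f : T -> R) : nu `<< mu -> bmeas f ->
  (forall x, 0 <= f x) ->
  (\int[nu]_x (f x)%:E <=
   Lnorm mu 2%:E (Radon_Nikodym (charge_of_finite_measure nu) mu) *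
   (Num.sqrt (\int[mu]_x (f x ^+ 2)))%:E)%E.
Proof.
move=> numu bf f0; have mu1 := @probability_setT _ _ _ mu.
have nu1 := @probability_setT _ _ _ nu.
pose D := Radon_Nikodym (charge_of_finite_measure nu) mu.
have numu' : charge_of_finite_measure nu `<< mu by [].
have iD := Radon_Nikodym_integrable numu'.
have mD : measurable_fun setT D by case/integrableP : iD.
have DE : D = EFin \o (fine \o D).
  by apply/funext => x /=; rewrite fineK//; exact: Radon_Nikodym_fin_num.
rewrite -(Radon_Nikodym_change_of_variables numu measurableT (bmeas_integrable nu1 bf)).
rewrite -/D -(Lnorm2_bmeas mu1 bf) muleC.
have mg : measurable_fun setT (fine \o D) by exact: measurableT_comp.
have h2 : 2^-1 + 2^-1 = 1 :> R by field.
have := hoelder mu bf.1 mg (ltr0n R 2) (ltr0n R 2) h2.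
rewrite -DE; apply: le_trans.
rewrite Lnorm1; apply: le_trans (lee_abs _) _.
apply: le_trans (le_abse_integral _ _ _) _ => //.
  by apply: emeasurable_funM => //; apply/measurable_EFinP; case: bf.
by rewrite le_eqVlt; apply/orP; left; apply/eqP; apply: eq_integral => x _; rewrite DE.
Qed.

Section exp_moment.
Context (R : realType) (E : ptopologicalType) (dO : measure_display)
  (Omega : measurableType dO) (X : R -> Omega -> borel E)
  (P : R.-pker (borel E) ~> Omega) (mu nu : probability (borel E) R).
Hypotheses (polishE : polish R E) (markovX : markov_process X P)
  (mu_inv : invariant_measure X P mu).
Let mu1 := @probability_setT _ _ _ mu.
Let P1 y := @prob_kernel _ _ _ _ _ P y.
Variables (F : R -> R) (k : R).
Hypotheses (k0 : 0 < k) (F_ln : forall x, 0 < x -> F x = k * ln x).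
Hypothesis mu_sobolev : F_sobolev X P mu F.
Hypothesis nu_mu : nu `<< mu.
Variables (W : borel E -> R) (K : R).
Hypotheses (mW : measurable_fun setT W) (W0 : forall y, 0 <= W y)
  (WK : forall y, W y <= K).
Let bW : bmeas W := bmeas_ge0_le mW W0 WK.

(** The expectation is the integral of the Feynman-Kac function with respect to
    nu.  The growth rate c is nonnegative because W is. *)
Lemma exp_moment T : 0 <= T ->
  (\int[law_from P nu]_w (expR (time_integral X W 0 T w))%:E <=
   Lnorm mu 2%:E (Radon_Nikodym (charge_of_finite_measure nu) mu) *
   (expR (k * ln (\int[mu]_x expR (W x / k)) * T))%:E)%E.
Proof.
move=> T0; set c := k * ln _.
have bu t : bmeas (feynman_kac X P W t) := bmeas_feynman_kac (P := P) markovX mW W0 WK t.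
have bA := bmeas_expR (bmeas_time (X := X) markovX mW W0 WK 0 T).
have c0 : 0 <= c.
  rewrite mulr_ge0 ?(ltW k0)// ln_ge0// -[leLHS](expect_cst mu1).
  apply: (expect_le mu1 (bmeas_cst _ _) (bmeas_expR (bmeasM bW (bmeas_cst _ k^-1)))) => x.
  by rewrite (le_trans _ (expR_ge1Dx _))// lerDl mulr_ge0// invr_ge0 ltW.
have energy t : 0 <= t -> \int[mu]_x (W x * feynman_kac X P W t x ^+ 2 +
    fk_generator X P W t x * feynman_kac X P W t x) <=
    c * \int[mu]_x (feynman_kac X P W t x ^+ 2).
  move=> t0; apply: (sobolev_energy markovX k0 F_ln mu_sobolev bW (bu t) _ ltr01).
  - exact: (bmeas_fk_generator (P := P) markovX mW W0 WK t0).
  - by move=> x; exact: (feynman_kac_ge1 (X := X) (P := P) markovX mW W0 WK).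
  - exact: (generator_feynman_kac polishE markovX mu_inv mW W0 WK t0).
have H := feynman_kac_norm polishE markovX mu_inv mW W0 WK c0 energy T0.
rewrite ge0_integral_law; last first.
  split; last by move=> w; rewrite lee_fin expR_ge0.
  by apply/measurable_EFinP; case: bA.
rewrite (eq_integral (fun x => (feynman_kac X P W T x)%:E)); last first.
  by move=> x _; rewrite (expect_EFin (P1 x) bA).
apply: le_trans (integral_density_le nu_mu (bu T) _) _.
  by move=> x; rewrite (le_trans ler01)//;
    exact: (feynman_kac_ge1 (X := X) (P := P) markovX mW W0 WK).
rewrite lee_wpmul2l ?Lnorm_ge0// lee_fin.
have -> : expR (c * T) = Num.sqrt (expR (2 * c * T)).
  have -> : 2 * c * T = c * T + c * T by ring.
  by rewrite expRD -expr2 sqrtr_sqr ger0_norm// expR_ge0.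
by rewrite ler_sqrt// expR_ge0.
Qed.

End exp_moment.

(** * Truncation of the potential *)

Section truncation.
Context (R : realType) d (T : measurableType d) (m : {measure set T -> \bar R})
  (D : set T).
Hypotheses (mD : measurable D) (Dy : (m D < +oo)%E).

Lemma clampE (n : nat) (y : R) : clamp n%:R y =
  Num.min (Num.max y 0) n%:R - Num.min (Num.max (- y) 0) n%:R.
Proof.
have n0 : (0 : R) <= n%:R by [].
rewrite /clamp; have /orP[y0|y0] := le_total y 0.
  have yn : y <= n%:R by exact: le_trans y0 n0.
  have Ny0 : 0 <= - y by rewrite oppr_ge0.
  by rewrite (min_r yn) (max_r y0) (max_l Ny0) (min_l n0) sub0r oppr_min opprK maxC.
have Ny0 : - y <= 0 by rewrite oppr_le0.
rewrite (max_l y0) (max_r Ny0) (min_l n0) subr0 [in RHS]minC max_r//.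
by rewrite (@le_trans _ _ 0)// ?oppr_le0// le_min n0.
Qed.

Lemma clamp_ge0_le (n : nat) (y : R) : clamp n%:R y <= Num.max y 0.
Proof.
have n0 : (0 : R) <= n%:R by [].
rewrite /clamp ge_max le_max ge_min !le_max lexx !orbT/= andbT.
by rewrite oppr_le0 n0 orbT.
Qed.

Lemma clamp_id (K y : R) : `|y| <= K -> clamp K y = y.
Proof.
rewrite ler_norml => /andP[h1 h2].
by rewrite /clamp (min_r h2) max_r.
Qed.

Lemma measurable_clamp (K : R) (f : T -> R) : measurable_fun setT f ->
  measurable_fun setT (fun x => clamp K (f x)).
Proof.
move=> mf; apply: (measurableT_comp _ mf).
exact: continuous_measurable_fun (@continuous_clamp R K).
Qed.

Lemma bmeas_clamp (n : nat) (f : T -> R) : measurable_fun setT f ->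
  bmeas (fun x => clamp n%:R (f x)).
Proof.
move=> mf; apply: (@bmeas_bounded _ _ _ _ n%:R); first exact: measurable_clamp.
by move=> x; exact: clamp_norm.
Qed.

Let cut (n : nat) (g : T -> R) x := Num.min (Num.max (g x) 0) n%:R.

Let bcut n g : measurable_fun setT g -> bmeas (cut n g).
Proof.
move=> mg; apply: (@bmeas_bounded _ _ _ _ n%:R).
  by apply: measurable_minr => //; exact: measurable_maxr.
move=> x; rewrite ger0_norm; last by rewrite /cut le_min le_max lexx orbT ler0n.
by rewrite /cut ge_min lexx orbT.
Qed.

(** The negative part of f has a finite integral, since otherwise the integral of
    f would be minus infinity; the truncated positive parts increase to an
    integral that may be infinite. *)
Lemma Rintegral_clamp_ge (f : T -> R) (b e : R) : measurable_fun setT f -> 0 < e ->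
  (b%:E <= \int[m]_(x in D) (f x)%:E)%E ->
  \forall n \near \oo, b - e <= \int[m]_(x in D) clamp n%:R (f x).
Proof.
move=> mf e0; rewrite integralE.
have mNf : measurable_fun setT (fun x => - f x) by exact: measurableT_comp.
have Efp : (EFin \o f)^\+%E = (fun x => (Num.max (f x) 0)%:E).
  by apply/funext => x; rewrite funeposE /= EFin_max.
have Efn : (EFin \o f)^\-%E = (fun x => (Num.max (- f x) 0)%:E).
  by apply/funext => x; rewrite funenegE /= EFin_max.
rewrite Efp Efn => bI.
have cvgp : (\int[m]_(x in D) (cut n f x)%:E)%E @[n --> \oo] -->
    (\int[m]_(x in D) (Num.max (f x) 0)%:E)%E.
  rewrite (eq_integral (fun x => limn (fun n => (cut n f x)%:E))); last first.
    move=> x _; apply/esym/cvg_lim => //; apply: cvg_near_cst.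
    have := archi_boundP (normr_ge0 (f x)); set N := Num.bound _ => hN.
    exists N => // n /= Nn; rewrite /cut; congr EFin; apply: min_l.
    rewrite ge_max ler0n andbT (le_trans (ler_norm _))// (le_trans (ltW hN))//.
    by rewrite ler_nat.
  apply: cvg_monotone_convergence => //.
  - by move=> n; apply/measurable_EFinP/measurable_funTS; case: (bcut n mf).
  - by move=> n x _; rewrite lee_fin /cut le_min le_max lexx orbT ler0n.
  - move=> x _ n n' nn; rewrite lee_fin /cut le_min !ge_min lexx /=.
    by rewrite ler_nat nn orbT.
have NfM : (\int[m]_(x in D) (Num.max (- f x) 0)%:E)%E \is a fin_num.
  rewrite ge0_fin_numE; last by apply: integral_ge0 => x _; rewrite lee_fin le_max lexx orbT.
  rewrite ltey; apply/eqP => h; move: bI; rewrite h.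
  by case: (\int[m]_(x in D) (Num.max (f x) 0)%:E)%E.
set M := (\int[m]_(x in D) (Num.max (- f x) 0)%:E)%E in bI NfM.
have bM : ((b - e + fine M)%:E < \int[m]_(x in D) (Num.max (f x) 0)%:E)%E.
  apply: (@lt_le_trans _ _ ((b + fine M)%:E)).
    by rewrite lte_fin ltrD2r ltrBlDr ltrDl.
  by rewrite EFinD fineK// -leeBrDr.
have cutM n : \int[m]_(x in D) cut n (fun x => - f x) x <= fine M.
  rewrite -lee_fin [leRHS]fineK// (Rintegral_EFin mD Dy (bcut n mNf)).
  apply: ge0_le_integral => //.
  - by move=> x _; rewrite lee_fin /cut le_min le_max lexx orbT ler0n.
  - by apply/measurable_EFinP/measurable_funTS; case: (bcut n mNf).
  - by apply/measurable_EFinP/measurable_funTS; exact: measurable_maxr.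
  - by move=> x _; rewrite lee_fin /cut ge_min lexx.
have : \forall n \near \oo, ((b - e + fine M)%:E < \int[m]_(x in D) (cut n f x)%:E)%E.
  exact: (cvgp _ (open_ereal_gt' bM)).
apply: filterS => n hn.
under eq_Rintegral do rewrite clampE.
rewrite (RintegralB mD (bmeas_integrable_on mD Dy (bcut n mf)) (bmeas_integrable_on
  mD Dy (bcut n mNf))).
rewrite -(Rintegral_EFin mD Dy (bcut n mf)) lte_fin in hn.
have := cutM n; move: (\int[m]_(x in D) cut n f x) hn.
by move: (\int[m]_(x in D) cut n (fun x => - f x) x) => r1 r2 h1 h2; lra.
Qed.

End truncation.

Lemma partition_limit_gt0 (R : realType) d (T : measurableType d)
    (mu : probability T R) (k : R) (V : T -> R) (l G : R) :
  measurable_fun setT V ->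
  (\int[mu]_x (expR (l * V x / k))%:E = G%:E)%E -> 0 < G.
Proof.
move=> mV HG; have mu1 := @probability_setT _ _ _ mu.
have mf : measurable_fun setT (fun x => (expR (l * V x / k))%:E).
  apply/measurable_EFinP; apply: measurableT_comp => //; apply: measurable_funM => //.
  exact: measurable_funM.
have G0 : 0 <= G.
  by rewrite -lee_fin -HG; apply: integral_ge0 => x _; rewrite lee_fin expR_ge0.
rewrite lt_neqAle G0 andbT; apply/eqP => G0'; move: HG; rewrite -G0' => HG.
have := (ae_eq_integral_abs mu measurableT mf).1.
under eq_integral do rewrite /= ger0_norm ?expR_ge0//.
move=> /(_ HG) [A [mA A0 sA]].
have : (mu setT <= mu A)%E.
  apply: le_measure; rewrite ?inE// => x _; apply: sA => /= /(_ I) [] /eqP.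
  by rewrite gt_eqF// expR_gt0.
by rewrite A0 mu1 leNgt lte_fin ltr01.
Qed.

Section truncated_moment.
Context (R : realType) (E : ptopologicalType) (dO : measure_display)
  (Omega : measurableType dO) (X : R -> Omega -> borel E)
  (P : R.-pker (borel E) ~> Omega) (mu nu : probability (borel E) R).
Hypotheses (polishE : polish R E) (markovX : markov_process X P)
  (mu_inv : invariant_measure X P mu).
Let mu1 := @probability_setT _ _ _ mu.
Variables (F : R -> R) (k : R).
Hypotheses (k0 : 0 < k) (F_ln : forall x, 0 < x -> F x = k * ln x).
Hypothesis mu_sobolev : F_sobolev X P mu F.
Hypothesis nu_mu : nu `<< mu.
Variables (V : borel E -> R).
Hypothesis (mV : measurable_fun setT V).
Notation leb := (@lebesgue_measure R).
Notation Vn n := (fun y : borel E => clamp n%:R (V y)).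
Notation N := (Lnorm mu 2%:E (Radon_Nikodym (charge_of_finite_measure nu) mu)).

Let bVn (n : nat) : bmeas (Vn n) := bmeas_clamp n mV.

Let Un (n : nat) y := clamp n%:R (V y) + n%:R.

Let Un0 n y : 0 <= Un n y.
Proof.
have := @clamp_norm R n%:R (V y) (ler0n _ _).
by rewrite ler_norml /Un -lerBlDr sub0r => /andP[].
Qed.

Let UnK n y : Un n y <= n%:R + n%:R.
Proof.
have := @clamp_norm R n%:R (V y) (ler0n _ _).
by rewrite ler_norml /Un lerD2r => /andP[].
Qed.

Let mUn n : measurable_fun setT (Un n).
Proof. exact: (bmeasD (bVn n) (bmeas_cst _ n%:R)).1. Qed.

Let mI t : measurable (`[0, t]%classic : set (measurableTypeR R)).
Proof. exact: measurable_itv. Qed.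

Let Iy t : (leb `[0%R, t]%classic < +oo)%E.
Proof. by rewrite lebesgue_measure_itv/=; case: ifP => _; rewrite ?ltry. Qed.

Definition truncated_integral (n : nat) (t : R) (w : Omega) : R :=
  time_integral X (Vn n) 0 t w.

Let truncE n t w : 0 <= t ->
  truncated_integral n t w = time_integral X (Un n) 0 t w - n%:R * t.
Proof.
move=> t0.
have bp := bmeas_pair2 (bmeas_path_fun markovX (bVn n)) w.
rewrite /time_integral /truncated_integral /time_integral.
rewrite (_ : \int[leb]_(r in `[0, t]) path_fun X (Un n) (r, w) =
  \int[leb]_(r in `[0, t]) (path_fun X (Vn n) (r, w) + n%:R))//.
rewrite (RintegralD (mI t) (bmeas_integrable_on (mI t) (Iy t) bp)); last first.
  exact: (bmeas_integrable_on (mI t) (Iy t) (bmeas_cst _ _)).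
by rewrite (Rintegral_cst _ (mI t)) (fine_leb t0) subr0 addrK.
Qed.

Lemma bmeas_truncated_integral n t : 0 <= t -> bmeas (truncated_integral n t).
Proof.
move=> t0; have b := bmeas_time (X := X) markovX (mUn n) (Un0 n) (UnK n) 0 t.
rewrite (_ : truncated_integral n t = fun w => time_integral X (Un n) 0 t w - n%:R * t).
  exact: bmeasB b (bmeas_cst _ _).
by apply/funext => w; rewrite truncE.
Qed.

Definition truncated_partition (l : R) (n : nat) : R :=
  \int[mu]_x expR (l * clamp n%:R (V x) / k).

(** Adding n makes the truncation nonnegative; the corresponding factor
    exp (l n t) appears on both sides and cancels. *)
Lemma truncated_moment l n t : 0 <= l -> 0 <= t ->
  (\int[law_from P nu]_w (expR (l * truncated_integral n t w))%:E <=
   N * (expR (k * ln (truncated_partition l n) * t))%:E)%E.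
Proof.
move=> l0 t0; pose W y := l * Un n y.
have bUn : bmeas (Un n) := bmeasD (bVn n) (bmeas_cst _ n%:R).
have bW : bmeas W := bmeasZ l bUn.
have W0 y : 0 <= W y by rewrite mulr_ge0.
have WK y : W y <= l * (n%:R + n%:R) by rewrite ler_wpM2l.
have bT := bmeas_truncated_integral n t0.
have beT := bmeas_expR (bmeasZ l bT).
have := exp_moment polishE markovX mu_inv k0 F_ln mu_sobolev nu_mu bW.1 W0 WK t0.
pose c := expR (l * n%:R * t).
have c0 : 0 < c by exact: expR_gt0.
have AW w : expR (time_integral X W 0 t w) = c * expR (l * truncated_integral n t w).
  rewrite -expRD truncE//; congr expR.
  have bU := bmeas_pair2 (bmeas_path_fun markovX (bmeasD (bVn n) (bmeas_cst _ n%:R))) w.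
  have -> : time_integral X W 0 t w = l * time_integral X (Un n) 0 t w.
    by rewrite /time_integral -(RintegralZl _ (mI t) (bmeas_integrable_on (mI t) (Iy t) bU)).
  by ring.
have ZW : \int[mu]_x expR (W x / k) = expR (l * n%:R / k) * truncated_partition l n.
  rewrite /truncated_partition.
  rewrite -(expectZ mu1 _ (bmeas_expR (bmeasM (bmeasZ l (bVn n)) (bmeas_cst _ k^-1)))).
  by apply: expect_eq => x; rewrite -expRD /W /Un; congr expR; rewrite !mulrDr mulrDl addrC.
have Z0 : 0 < truncated_partition l n by exact: (partition_gt0 mu k0 (bmeasZ l (bVn n))).
rewrite ZW lnM ?posrE ?expR_gt0// expRK.
have -> : k * (l * n%:R / k + ln (truncated_partition l n)) * t =
  l * n%:R * t + k * ln (truncated_partition l n) * t by field; rewrite gt_eqF.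
rewrite expRD -/c.
under eq_integral do rewrite AW EFinM.
have e0 w : (0 <= (expR (l * truncated_integral n t w))%:E)%E.
  by rewrite lee_fin expR_ge0.
have me : measurable_fun setT (fun w => (expR (l * truncated_integral n t w))%:E).
  by apply/measurable_EFinP; case: beT.
rewrite (ge0_integralZl_EFin _ measurableT (fun w _ => e0 w) me (ltW c0)).
by rewrite EFinM muleCA lee_pmul2l// lte_fin.
Qed.

(** Dominated convergence with bound exp (l V / k) + 1, as l >= 0 and the
    truncation of V is at most max V 0. *)
Lemma truncated_partition_cvg l G : 0 <= l ->
  (\int[mu]_x (expR (l * V x / k))%:E = G%:E)%E ->
  truncated_partition l n @[n --> \oo] --> G.
Proof.
move=> l0 HG; have mf : measurable_fun setT (fun x => expR (l * V x / k)).
  apply: measurableT_comp => //; apply: measurable_funM => //.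
  exact: measurable_funM.
suff : (\int[mu]_x (expR (l * clamp n%:R (V x) / k))%:E)%E @[n --> \oo] --> G%:E.
  by move=> /fine_cvgP[].
rewrite -HG; apply: (dominated_cvg measurableT (g := fun x => (expR (l * V x / k) + 1)%:E)) => //.
- move=> n; apply/measurable_EFinP.
  by case: (bmeas_expR (bmeasM (bmeasZ l (bVn n)) (bmeas_cst _ k^-1))).
- move=> x _; apply: cvg_near_cst.
  have := archi_boundP (normr_ge0 (V x)); set M := Num.bound _ => hM.
  exists M => // n /= Mn; rewrite clamp_id// (le_trans (ltW hM))//.
  by rewrite ler_nat.
- have i1 : mu.-integrable setT (fun x => (expR (l * V x / k))%:E).
    apply/integrableP; split; first exact/measurable_EFinP.
    under eq_integral do rewrite /= ger0_norm ?expR_ge0//.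
    by rewrite HG ltry.
  exact: integrableD i1 (bmeas_integrable mu1 (bmeas_cst _ 1)).
- move=> n x _; rewrite /= lee_fin ger0_norm ?expR_ge0//.
  have lk : 0 <= l / k by rewrite divr_ge0// ltW.
  have h := clamp_ge0_le n (V x).
  rewrite mulrAC [in leRHS]mulrAC.
  have [v0|v0] := leP (V x) 0.
    rewrite (max_r v0) in h; rewrite (@le_trans _ _ 1)// ?lerDr ?expR_ge0//.
    by rewrite -[leRHS]expR0 ler_expR mulr_ge0_le0.
  rewrite (max_l (ltW v0)) in h; rewrite (@le_trans _ _ (expR (l / k * V x)))// ?lerDl//.
  by rewrite ler_expR ler_wpM2l.
Qed.

End truncated_moment.

(** * Deviations of the time integral *)

Section einf.
Context (R : realType).
Local Open Scope ereal_scope.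

Lemma le_limn_einf (c : \bar R) (u : (\bar R)^nat) :
  (\forall n \near \oo, c <= u n) -> c <= limn_einf u.
Proof.
move=> [N _ HN]; rewrite limn_einf_lim; apply: lime_ge; first exact: is_cvg_einfs.
exists N => // n /= Nn; apply: le_ereal_inf_tmp => _ [m /= nm <-].
by apply: HN; exact: leq_trans nm.
Qed.

Lemma limn_einf_le (c : \bar R) (u : (\bar R)^nat) :
  (\forall n \near \oo, u n <= c) -> limn_einf u <= c.
Proof.
move=> [N _ HN]; rewrite limn_einf_lim; apply: lime_le; first exact: is_cvg_einfs.
exists N => // n /= Nn; apply: (@le_trans _ _ (u n)); last exact: HN.
by apply: ereal_inf_lbound; exists n => /=.
Qed.

Lemma measurable_time_integral d (T : measurableType d)
    (D : set (measurableTypeR R)) (f : measurableTypeR R * T -> R) :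
  measurable D -> measurable_fun setT f ->
  measurable_fun setT (fun w => \int[lebesgue_measure]_(s in D) (f (s, w))%:E).
Proof.
move=> mD mf.
have pos (g : measurableTypeR R * T -> R) : measurable_fun setT g ->
    (forall p, 0 <= g p)%R ->
    measurable_fun setT (fun w => \int[lebesgue_measure]_(s in D) (g (s, w))%:E).
  move=> mg g0; pose h p : \bar R := (g p * \1_D p.1)%:E.
  have mh : measurable_fun setT h.
    apply/measurable_EFinP; apply: measurable_funM => //.
    by apply: (measurableT_comp (measurable_indic mD)); exact: measurable_fst.
  have h0 p : 0 <= h p by rewrite lee_fin mulr_ge0.
  have := @measurable_fun_fubini_tonelli_G _ _ _ _ _ (@lebesgue_measure R) _ mh h0.
  congr measurable_fun; apply/funext => w; rewrite /fubini_G [RHS]integral_mkcond.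
  apply: eq_integral => s _; rewrite /patch /h/= indicE.
  by case: ifP => sD; rewrite ?mulr1 ?mulr0.
have -> : (fun w => \int[lebesgue_measure]_(s in D) (f (s, w))%:E) = (fun w =>
    \int[lebesgue_measure]_(s in D) (Num.max (f (s, w)) 0)%:E -
    \int[lebesgue_measure]_(s in D) (Num.max (- f (s, w)) 0)%:E).
  apply/funext => w; rewrite integralE; congr (_ - _); apply: eq_integral => s _.
    by rewrite funeposE EFin_max.
  by rewrite funenegE EFin_max.
apply: emeasurable_funB.
  apply: (pos (fun p => Num.max (f p) 0)%R); first exact: measurable_maxr.
  by move=> p; rewrite le_max lexx orbT.
apply: (pos (fun p => Num.max (- f p) 0)%R); last first.
  by move=> p; rewrite le_max lexx orbT.
by apply: measurable_maxr => //; exact: measurableT_comp.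
Qed.

End einf.

Lemma le_expR_mul (R : realType) (p q : R) : 0 <= q ->
  (forall e, 0 < e -> p <= q * expR e) -> p <= q.
Proof.
move=> q0 H; apply/ler_addgt0Pr => e e0.
have q1 : 0 < q + 1 by rewrite ltr_wpDl.
have d1 : 1 < 1 + e / (q + 1) by rewrite ltrDl divr_gt0.
have := H (ln (1 + e / (q + 1))); rewrite ln_gt0// => /(_ isT).
rewrite lnK ?posrE; last by rewrite (lt_trans ltr01).
move=> h; apply: (le_trans h); rewrite mulrDr mulr1 lerD2l mulrCA -[leRHS]mulr1.
by rewrite ler_wpM2l ?(ltW e0)// ler_pdivrMr// mul1r lerDl.
Qed.

Section deviation.
Context (R : realType) (E : ptopologicalType) (dO : measure_display)
  (Omega : measurableType dO) (X : R -> Omega -> borel E)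
  (P : R.-pker (borel E) ~> Omega) (mu nu : probability (borel E) R).
Hypotheses (polishE : polish R E) (markovX : markov_process X P)
  (mu_inv : invariant_measure X P mu).
Let mu1 := @probability_setT _ _ _ mu.
Variables (F : R -> R) (k : R).
Hypotheses (k0 : 0 < k) (F_ln : forall x, 0 < x -> F x = k * ln x).
Hypothesis mu_sobolev : F_sobolev X P mu F.
Hypothesis nu_mu : nu `<< mu.
Variables (V : borel E -> R).
Hypothesis (mV : measurable_fun setT V).
Notation leb := (@lebesgue_measure R).
Notation N := (Lnorm mu 2%:E (Radon_Nikodym (charge_of_finite_measure nu) mu)).

Definition path_integral (t : R) (w : Omega) : \bar R :=
  (\int[leb]_(s in `[0%R, t]) (V (X s w))%:E)%E.

Let mI t : measurable (`[0, t]%classic : set (measurableTypeR R)).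
Proof. exact: measurable_itv. Qed.

Let Iy t : (leb `[0%R, t]%classic < +oo)%E.
Proof. by rewrite lebesgue_measure_itv/=; case: ifP => _; rewrite ?ltry. Qed.

Let mVX : measurable_fun setT (path_fun X V) := measurableT_comp mV (measurable_path markovX).

Let path_integralE t w : path_integral t w =
  (\int[leb]_(s in `[0%R, t]) (path_fun X V (s, w))%:E)%E.
Proof.
apply: eq_integral => s; rewrite inE/= in_itv/= => /andP[s0 _].
by rewrite /path_fun/= ger0_norm.
Qed.

Lemma measurable_path_integral t : measurable_fun setT (path_integral t).
Proof.
have := measurable_time_integral (mI t) mVX.
by congr measurable_fun; apply/funext => w; rewrite path_integralE.
Qed.

(** Chebyshev's inequality for the exponential of the time integral of l V.
    Where the time integral of V is at least b, those of the truncations are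
    eventually at least b - e, so Fatou's lemma transfers the bound for
    truncations. *)
Lemma deviation_exponential (l t b n G : R) (S : set Omega) : 0 <= l -> 0 <= t ->
  N = n%:E -> (\int[mu]_x (expR (l * V x / k))%:E = G%:E)%E ->
  measurable S -> (forall w, S w -> (b%:E <= path_integral t w)%E) ->
  (law_from P nu S <= (n * expR (k * ln G * t - l * b))%:E)%E.
Proof.
move=> l0 t0 Nn HG mS Sb.
have G0 : 0 < G := partition_limit_gt0 mV HG.
have n0 : 0 <= n by rewrite -lee_fin -Nn Lnorm_ge0.
have fS : law_from P nu S \is a fin_num by exact: fin_num_measure.
rewrite -[leLHS]fineK// lee_fin; apply: le_expR_mul; first by rewrite mulr_ge0// expR_ge0.
move=> eta eta0; rewrite -lee_fin fineK//.
(* One half of eta pays for the loss l e in the exponent, the other half for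
   replacing the truncated partition functions by their limit. *)
have eta2 : 0 < eta / 2 by rewrite divr_gt0.
pose e := eta / 2 / (l + 1).
have l1 : 0 < l + 1 by rewrite ltr_wpDl.
have e0 : 0 < e by rewrite divr_gt0.
have le : l * e <= eta / 2.
  rewrite /e mulrCA -[leRHS]mulr1 ler_wpM2l ?(ltW eta2)//.
  by rewrite ler_pdivrMr// mul1r lerDl.
pose phi n w : \bar R := (expR (l * truncated_integral X V n t w) * expR (l * e - l * b))%:E.
have bT n' := bmeas_truncated_integral markovX mV n' t0.
have beT n' := bmeas_expR (bmeasZ l (bT n')).
have phi0 n' w : (0 <= phi n' w)%E by rewrite lee_fin mulr_ge0 ?expR_ge0.
have mphi n' : measurable_fun setT (phi n').
  by apply/measurable_EFinP; case: (bmeasM (beT n') (bmeas_cst _ (expR (l * e - l * b)))).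
have low : (law_from P nu S <= \int[law_from P nu]_w limn_einf (phi ^~ w))%E.
  rewrite -[S in leLHS]setIT -integral_indic//.
  apply: ge0_le_integral => //.
  - by apply/measurable_EFinP; exact: measurable_indic.
  - apply: (emeasurable_fun_cvg (fun n' w => einfs (phi ^~ w) n')).
      by move=> n'; exact: measurable_fun_einfs.
    by move=> w _; rewrite limn_einf_lim; exact: is_cvg_einfs.
  move=> w _; rewrite indicE; case: (boolP (w \in S)) => [|_]; last first.
    by apply: le_limn_einf; apply: nearW.
  rewrite inE => Sw; apply: le_limn_einf.
  have bI : (b%:E <= \int[leb]_(s in `[0%R, t]) (path_fun X V (s, w))%:E)%E.
    by rewrite -path_integralE; exact: Sb.
  have mVw : measurable_fun setT (fun s => path_fun X V (s, w)).
    by apply: measurableT_comp mVX _; exact: pair2_measurable.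
  have := Rintegral_clamp_ge (mI t) (Iy t) mVw e0 bI.
  apply: filterS => n' hn; rewrite lee_fin -expRD -[leLHS]expR0 ler_expR.
  have h : b - e <= truncated_integral X V n' t w by exact: hn.
  have -> : l * truncated_integral X V n' t w + (l * e - l * b) =
    l * (truncated_integral X V n' t w - (b - e)) by ring.
  by rewrite mulr_ge0// subr_ge0.
apply: (le_trans low); apply: (le_trans (fatou _ measurableT mphi (fun n' w _ => phi0 n' w))).
apply: limn_einf_le.
have cvgln : k * ln (truncated_partition mu k V l n') * t @[n' --> \oo] --> k * ln G * t.
  apply: cvgMl; apply: cvgMr.
  by apply: continuous_cvg; [exact: continuous_ln|exact: truncated_partition_cvg].
have : \forall n' \near \oo, k * ln (truncated_partition mu k V l n') * t <= k * ln G * t + eta / 2.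
  have /cvgrPdist_le/(_ _ eta2) := cvgln; apply: filterS => n'.
  rewrite ler_norml => /andP[h _]; rewrite lerBrDl in h.
  by move: h; move: (k * ln G * t) (k * ln _ * t) => x y h; lra.
apply: filterS => n' hn.
have -> : (\int[law_from P nu]_w phi n' w =
    \int[law_from P nu]_w (expR (l * truncated_integral X V n' t w))%:E *
    (expR (l * e - l * b))%:E)%E.
  have ge0 w : (0 <= (expR (l * truncated_integral X V n' t w))%:E)%E.
    by rewrite lee_fin expR_ge0.
  have me : measurable_fun setT (fun w => (expR (l * truncated_integral X V n' t w))%:E).
    by apply/measurable_EFinP; case: (beT n').
  have c0 : (0 <= (expR (l * e - l * b))%:E)%E by rewrite lee_fin expR_ge0.
  by rewrite -(ge0_integralZr _ measurableT me (fun w _ => ge0 w) c0).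
apply: (@le_trans _ _ (N * (expR (k * ln (truncated_partition mu k V l n') * t))%:E *
   (expR (l * e - l * b))%:E)%E).
  rewrite lee_wpmul2r ?lee_fin ?expR_ge0//.
  exact: (truncated_moment polishE markovX mu_inv k0 F_ln mu_sobolev nu_mu mV).
rewrite Nn -!EFinM lee_fin -[leLHS]mulrA -[leRHS]mulrA ler_wpM2l// -!expRD ler_expR.
move: hn le; move: (k * ln G * t) (l * e) (l * b) => x1 x2 x3.
by move: (k * ln _ * t) => x4 hn le; lra.
Qed.

End deviation.

(** * The rate function and the deviation inequality *)

Section rate_function.
Context (R : realType) d (T : measurableType d) (mu nu : probability T R).
Variables (F : R -> R) (k : R).
Hypotheses (k0 : 0 < k) (F_ln : forall x, 0 < x -> F x = k * ln x).
Variable V : T -> R.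
Hypothesis mV : measurable_fun setT V.

Let partition (l : R) : \bar R := (\int[mu]_x (expR (l * V x / k))%:E)%E.

Let mexp l : measurable_fun setT (fun x => (expR (l * V x / k))%:E).
Proof.
apply/measurable_EFinP; apply: measurableT_comp => //; apply: measurable_funM => //.
exact: measurable_funM.
Qed.

Lemma partition_cases l : partition l = +oo%E \/ exists2 G, 0 < G & partition l = G%:E.
Proof.
have p0 : (0 <= partition l)%E.
  by apply: integral_ge0 => x _; rewrite lee_fin expR_ge0.
case E : (partition l) p0 => [G||]//; last by left.
move=> _; right; exists G => //.
exact: partition_limit_gt0 mV E.
Qed.

Let F_inv_partition l : (\int[mu]_x (F_inv F (l * V x))%:E)%E = partition l.
Proof. by apply: eq_integral => x _; rewrite (F_inv_ln k0 F_ln). Qed.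

(** Centering V multiplies the partition function by exp (- l m / k), and the
    logarithm turns this factor into the term l m. *)
Lemma H_star_shift (lam : \bar R) (m r : R) :
  H_star F mu (fun x => V x - m) lam r = H_star F mu V lam (r + m).
Proof.
rewrite /H_star; congr ereal_sup; apply: eq_imagel => l _.
have -> : (\int[mu]_x (F_inv F (l * (V x - m)))%:E)%E = ((expR (- (l * m / k)))%:E * partition l)%E.
  have e0 x : (0 <= (expR (l * V x / k))%:E)%E by rewrite lee_fin expR_ge0.
  rewrite -(ge0_integralZl_EFin _ measurableT (fun x _ => e0 x) (mexp l) (expR_ge0 _)).
  apply: eq_integral => x _; rewrite (F_inv_ln k0 F_ln) -EFinM -expRD.
  by congr (expR _)%:E; ring.
rewrite F_inv_partition; have [->|[G G0 ->]] := partition_cases l.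
  by rewrite gt0_muley ?lte_fin ?expR_gt0.
rewrite -EFinM /F_ext G0 mulr_gt0 ?expR_gt0// !F_ln ?mulr_gt0 ?expR_gt0//.
rewrite lnM ?posrE ?expR_gt0// expRK -!EFinB; congr EFin.
by field; rewrite gt_eqF.
Qed.

(** If p > 0, taking logarithms bounds every term of the supremum by
    (ln n - ln p) / t, which is free of l; so the supremum obeys the same bound.
    The choice l = 0 shows that n > 0. *)
Lemma le_deviation_bound (lam : \bar R) (a t : R) (p : R) : (0 < lam)%E -> 0 < t ->
  0 <= p ->
  (forall l G n, 0 <= l -> partition l = G%:E ->
    Lnorm mu 2%:E (Radon_Nikodym (charge_of_finite_measure nu) mu) = n%:E ->
    p <= n * expR (k * ln G * t - l * (a * t))) ->
  (p%:E <= deviation_bound mu nu t (H_star F mu V lam a))%E.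
Proof.
move=> lam0 t0 p0 H; rewrite /deviation_bound; case: ifPn => [_|]; first exact: leey.
have := @Lnorm_ge0 _ _ _ mu 2%:E (Radon_Nikodym (charge_of_finite_measure nu) mu).
case: (Lnorm _ _ _) H => [n||]// H; rewrite ?lee_fin => n0 _.
have [->|pn0] := eqVneq p 0; first by rewrite mule_ge0// expeR_ge0.
have {p0 pn0}p0 : 0 < p by rewrite lt_neqAle eq_sym pn0.
have npos l G : 0 <= l -> partition l = G%:E -> 0 < n.
  move=> l0 HG; rewrite lt_neqAle n0 andbT; apply/eqP => n00.
  by have := H l G n l0 HG erefl; rewrite -n00 mul0r leNgt p0.
have p1 : partition 0 = 1%:E.
  transitivity (\int[mu]_x (1%:E : \bar R))%E.
    by apply: eq_integral => x _; rewrite !mul0r expR0.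
  by rewrite integral_cst// mul1e; exact: probability_setT.
have {}n0 := npos 0 1 (lexx 0) p1.
have sup_le : (H_star F mu V lam a <= ((ln n - ln p) / t)%:E)%E.
  apply: ge_ereal_sup => _ [l [l0 _] <-].
  rewrite F_inv_partition; have [->|[G Gpos HG]] := partition_cases l.
    by rewrite /= leNye.
  rewrite HG /F_ext Gpos F_ln// -EFinB lee_fin ler_pdivlMr//.
  have := H l G n l0 HG erefl.
  rewrite -ler_ln ?posrE ?mulr_gt0 ?expR_gt0// lnM ?posrE ?expR_gt0// expRK => h.
  rewrite lerBrDr -lerBrDl (le_trans h)// le_eqVlt; apply/orP; left; apply/eqP; ring.
apply: (@le_trans _ _ (n%:E * expeR (- (t%:E * ((ln n - ln p) / t)%:E)))%E).
  have -> : (t%:E * ((ln n - ln p) / t)%:E = (ln n - ln p)%:E)%E.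
    by rewrite -EFinM mulrC divfK// gt_eqF.
  rewrite /= opprB -EFinM lee_fin expRD expRN !lnK ?posrE//.
  by rewrite mulrC divfK// gt_eqF.
rewrite lee_wpmul2l ?lee_fin ?(ltW n0)// lee_expeR leeN2.
by rewrite lee_wpmul2l// lee_fin ltW.
Qed.

End rate_function.

Theorem theorem2p1 (R : realType) (E : ptopologicalType)
    (dO : measure_display) (Omega : measurableType dO)
    (X : R -> Omega -> borel E) (P : R.-pker (borel E) ~> Omega)
    (mu nu : probability (borel E) R) (F : R -> R) (V : borel E -> R)
    (polishE : polish R E)
    (markovX : markov_process X P)
    (mu_inv : invariant_measure X P mu)
    (mu_erg : ergodic_measure X P mu)
    (gaugeF : sobolev_gauge F)
    (F_submul : forall x y : R, 0 < x -> 0 < y -> F (x * y) <= F x + F y)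
    (mu_sobolev : F_sobolev X P mu F)
    (V_int : mu.-integrable [set: borel E] (EFin \o V))
    (nu_mu : nu `<< mu) :
  let m := \int[mu]_x V x in
  let Vc := fun x => V x - m in
  let deviation (r t : R) := [set w : Omega |
    (r%:E <= (t^-1)%:E * (\int[lebesgue_measure]_(s in `[0%R, t]) (V (X s w))%:E)
             - m%:E)%E] in
  [/\ forall lamV : \bar R, admissible F mu V lamV ->
        forall r t : R, 0 < r -> 0 < t ->
          (law_from P nu (deviation r t) <=
           deviation_bound mu nu t (H_star F mu V lamV (r + m)))%E,
      forall lamV' : \bar R, admissible F mu Vc lamV' ->
        forall r t : R, 0 < r -> 0 < t ->
          (law_from P nu (deviation r t) <=
           deviation_bound mu nu t (H_star F mu Vc lamV' r))%E &
      F_at0 F = -oo%E ->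
        [/\ admissible F mu V +oo%E, admissible F mu Vc +oo%E &
            forall r : R, 0 < r ->
              (H_star F mu V +oo%E (r + m) <= H_star F mu Vc +oo%E r)%E]].
Proof.
move=> m Vc deviation.
have [k k0 F_ln] := gauge_ln gaugeF F_submul.
have mV : measurable_fun setT V by case/integrableP : V_int => /measurable_EFinP.
have main lam r t : (0 < lam)%E -> 0 < r -> 0 < t ->
    (law_from P nu (deviation r t) <=
     deviation_bound mu nu t (H_star F mu V lam (r + m)))%E.
  move=> lam0 r0 t0.
  have mS : measurable (deviation r t).
    rewrite -[deviation r t]setTI.
    apply: (@emeasurable_fun_c_infty _ _ _ setT (fun w => (t^-1)%:E * path_integral
      X V t w - m%:E)%E) => //.
    apply: emeasurable_funB => //; apply: measurable_funeM.
    exact: (measurable_path_integral markovX mV t).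
  have sub w : deviation r t w -> (((r + m) * t)%:E <= path_integral X V t w)%E.
    rewrite /deviation /= -/(path_integral X V t w).
    case: (path_integral X V t w) => [I||].
    - rewrite -EFinM -EFinB !lee_fin => h.
      by rewrite -ler_pdivlMr// mulrC -lerBrDr.
    - by rewrite leey.
    - by rewrite gt0_muleNy ?lte_fin ?invr_gt0.
  have fS : law_from P nu (deviation r t) \is a fin_num by exact: fin_num_measure.
  rewrite -[leLHS]fineK//.
  apply: (le_deviation_bound k0 F_ln mV lam0 t0); first exact: fine_ge0.
  move=> l G n l0 HG Nn; rewrite -lee_fin fineK//.
  exact: (deviation_exponential polishE markovX mu_inv k0 F_ln mu_sobolev nu_mu
    mV l0 (ltW t0) Nn HG mS sub).
split.
- by move=> lam [lam0 _] r t r0 t0; exact: main.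
- by move=> lam [lam0 _] r t r0 t0; rewrite (H_star_shift mu k0 F_ln mV); exact: main.
move=> F0.
have adm U : admissible F mu U +oo%E.
  by split => // l _ _; apply: aeW => x; rewrite F0 ltNye.
split => // r _.
by rewrite (H_star_shift mu k0 F_ln mV).
Qed.
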